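(* Let $G_m$ be a bounded Vilenkin group. Then there exists a martingale $f\in H_1(G_m)$ such that $$\sup_{n\in\mathbb{N}_+}\left\Vert L_n f\right\Vert_1=+\infty ,$$ where $L_n f$ denotes the $n$-th Nörlund logarithmic mean of the Vilenkin-Fourier series of $f$.
   Context: $\mathbb{N}_+$ is the set of positive integers, $\mathbb{N}=\mathbb{N}_+\cup\{0\}$. Vilenkin group. Let $m=(m_0,m_1,\dots)$ be a sequence of integers $m_k\ge 2$, and $Z_{m_k}=\{0,1,\dots,m_k-1\}$ the additive group of integers modulo $m_k$ with the discrete topology. $G_m$ is the complete direct product of the groups $Z_{m_k}$, with the product topology; its elements are sequences $x=(x_0,x_1,\dots)$, $x_k\in Z_{m_k}$. $\mu$ is the normalized Haar measure on $G_m$, i.e. the product of the measures $\mu_k(\{j\})=1/m_k$. $G_m$ is called bounded if $\sup_n m_n<\infty$. For $x\in G_m$ put $I_0(x)=G_m$ and $I_n(x)=\{y\in G_m: y_0=x_0,\dots,y_{n-1}=x_{n-1}\}$. Vilenkin system. Let $M_0=1$, $M_{k+1}=m_kM_k$. Every $n\in\mathbb{N}$ is uniquely $n=\sum_{k=0}^\infty n_kM_k$ with $n_k\in Z_{m_k}$ and only finitely many $n_k\neq 0$. Let $r_k(x)=\exp(2\pi i x_k/m_k)$ and $\psi_n(x)=\prod_{k=0}^\infty r_k(x)^{n_k}$. Fourier series. For $f\in L_1(G_m)$ let $\widehat f(n)=\int_{G_m} f\,\overline{\psi_n}\,d\mu$ and $S_nf=\sum_{k=0}^{n-1}\widehat f(k)\psi_k$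 (so $S_0f=0$). The Nörlund logarithmic means are, for $n\in\mathbb{N}_+$, $$L_nf=\frac1{l_n}\sum_{k=0}^{n-1}\frac{S_kf}{n-k},\qquad l_n=\sum_{k=1}^n\frac1k .$$ $\|f\|_1=\int_{G_m}|f|\,d\mu$. Hardy space. The maximal function of $f\in L_1(G_m)$ is $f^*(x)=\sup_{n\in\mathbb{N}}\frac{1}{\mu(I_n(x))}\left|\int_{I_n(x)}f\,d\mu\right|$. The martingale Hardy space $H_1(G_m)$ consists of all martingales $f$ (with respect to the filtration generated by the sets $I_n(x)$) for which $\|f\|_{H_1}:=\|f^*\|_1<\infty$; such martingales are identified with functions $f\in L_1(G_m)$ with $f^*\in L_1(G_m)$. *)

(* Defs.v *)
From HB Require Import structures.
From mathcomp Require Import all_boot all_order all_algebra.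
From mathcomp Require Import all_classical all_reals all_analysis.
From mathcomp Require Import complex.
Set Implicit Arguments.
Unset Strict Implicit.
Unset Printing Implicit Defensive.
Import Order.TTheory GRing.Theory Num.Theory.

Local Open Scope classical_set_scope.
Local Open Scope ring_scope.

(* 'Z_n is Z/nZ only for 1 < n: everything below is meant for sequences m with
   1 < m k for all k. *)
Definition vilenkin_space (m : nat -> nat) :=
  prod_topology (fun k => discrete_topology 'Z_(m k)).

HB.instance Definition _ m := Topological.on (vilenkin_space m).
HB.instance Definition _ m := isPointed.Build (vilenkin_space m) (fun=> 0).

(* The same set, as a measurable space with its Borel sigma-algebra. *)
Definition vilenkin (m : nat -> nat) :=
  g_sigma_algebraType (@open (vilenkin_space m)).

(* The normalized Haar measure: the product of the uniform probabilities
   mu_k(A) = #|A| / m k on the factors Z_(m k), given by its values on the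
   measurable rectangles, which determine it. *)
Definition vilenkin_haar (R : realType) (m : nat -> nat)
    (mu : {measure set (vilenkin m) -> \bar R}) :=
  forall (n : nat) (A : forall k, {set 'Z_(m k)}),
    mu [set x | forall k, (k < n)%N -> x k \in A k] =
    (\prod_(k < n) (#|A k|%:R / (m k)%:R))%:E.

Section VilenkinSystem.
Local Open Scope complex_scope.
Variables (R : realType) (m : nat -> nat).
Implicit Types (x y : vilenkin m) (k n : nat).

Definition vilenkin_I n x : set (vilenkin m) :=
  [set y | forall k, (k < n)%N -> y k = x k].

Definition vilenkin_M k : nat := (\prod_(i < k) m i)%N.

(* The coefficient n_k of the expansion n = \sum_k n_k * M_k. *)
Definition vilenkin_digit n k : nat := ((n %/ vilenkin_M k) %% m k)%N.

Definition rademacher k x : R[i] :=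
  let t := 2 * pi * (x k : nat)%:R / (m k)%:R in cos t +i* sin t.

(* The digits n_k with n <= k vanish (lemma vilenkin_digit_eq0), so this finite
   product is the infinite one. *)
Definition vilenkin_psi n x : R[i] :=
  \prod_(k < n) rademacher k x ^+ vilenkin_digit n k.

Lemma vilenkin_M_ltn : (forall k, 1 < m k)%N -> forall k, (k < vilenkin_M k)%N.
Proof.
move=> m1; elim=> [|k IH]; first by rewrite /vilenkin_M big_ord0.
rewrite /vilenkin_M big_ord_recr /= -/(vilenkin_M k).
apply: (@leq_trans (vilenkin_M k * 2)); last by rewrite leq_mul2l m1 orbT.
by rewrite muln2 -addnn -addn1 leq_add// (leq_trans _ IH).
Qed.

Lemma vilenkin_digit_eq0 : (forall k, 1 < m k)%N ->
  forall n k, (n <= k)%N -> vilenkin_digit n k = 0%N.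
Proof.
move=> m1 n k nk; rewrite /vilenkin_digit divn_small ?mod0n//.
exact: leq_ltn_trans nk (vilenkin_M_ltn m1 k).
Qed.

Lemma vilenkin_digit_sum : (forall k, 1 < m k)%N ->
  forall n, n = (\sum_(k < n) vilenkin_digit n k * vilenkin_M k)%N.
Proof.
move=> m1 n.
have H j : (n = \sum_(k < j) vilenkin_digit n k * vilenkin_M k
              + n %/ vilenkin_M j * vilenkin_M j)%N.
  elim: j => [|j IH].
    by rewrite big_ord0 /vilenkin_M big_ord0 divn1 muln1.
  rewrite big_ord_recr /= {1}IH -addnA; congr addn.
  have -> : vilenkin_M j.+1 = (vilenkin_M j * m j)%N.
    by rewrite /vilenkin_M big_ord_recr.
  rewrite divnMA /vilenkin_digit {1}(divn_eq (n %/ vilenkin_M j) (m j)).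
  by rewrite mulnDl addnC [in RHS](mulnC (vilenkin_M j)) mulnA.
by rewrite {1}(H n) divn_small ?addn0// vilenkin_M_ltn.
Qed.

End VilenkinSystem.

(* Existence of the measure mu of vilenkin_haar: the image of the Lebesgue
   measure on [0, 1[ under t |-> (floor (t * M_{k+1}) mod m_k)_k. *)
Section HaarExistence.
Variables (R : realType) (m : nat -> nat).
Hypothesis m1 : forall k, (1 < m k)%N.
Let M := vilenkin_M m.

Local Lemma MS n : M n.+1 = (M n * m n)%N.
Proof. by rewrite /M /vilenkin_M big_ord_recr. Qed.
Local Lemma M0 n : (0 < M n)%N.
Proof. exact: leq_ltn_trans (vilenkin_M_ltn m1 n). Qed.

Local Definition g n (t : R) : nat := Num.truncn (t * (M n)%:R).
Local Definition phi (t : R) : vilenkin m :=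
  fun k => (inZp (g k.+1 t) : 'Z_(m k)).

Local Lemma gdiv n t : (g n.+1 t %/ m n)%N = g n t.
Proof.
rewrite /g; have [t0|t0] := leP 0 t; last first.
  have h a : Num.truncn (t * a%:R) = 0%N.
    by apply/Num.Theory.truncn0Pn; rewrite -ltNge
       (le_lt_trans _ ltr01)// mulr_le0_ge0// ltW.
  by rewrite !h div0n.
apply/esym/Num.Theory.truncn_def.
have mp : 0 < (m n)%:R :> R by rewrite ltr0n ltnW.
have /Num.Theory.truncn_itv : 0 <= t * (M n.+1)%:R by rewrite mulr_ge0.
set N := Num.truncn _; rewrite MS natrM mulrA => /andP[h1 h2].
rewrite -(ler_pM2r mp) -(ltr_pM2r mp) -!natrM.
rewrite (le_trans _ h1) ?ler_nat ?leq_divM//=.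
by rewrite (lt_le_trans h2)// ler_nat ltn_ceil// ltnW.
Qed.

Local Lemma g_ge n j t : (0 < j)%N -> (j <= g n t)%N = (j%:R / (M n)%:R <= t).
Proof.
move=> j0; have Mp : 0 < (M n)%:R :> R by rewrite ltr0n M0.
rewrite ler_pdivrMr// /g; case: j j0 => // j _; exact: Num.Theory.truncn_gt_nat.
Qed.

Local Lemma measurable_ge n j : measurable [set t : R | (j <= g n t)%N].
Proof.
case: j => [|j].
  by rewrite (_ : [set _ | _] = setT)//; apply/seteqP; split.
rewrite (_ : [set _ | _] = `[j.+1%:R / (M n)%:R, +oo[%classic)//.
by apply/seteqP; split => t /=; rewrite in_itv/= andbT g_ge.
Qed.

Local Lemma measurable_gP n (P : set nat) : measurable [set t : R | P (g n t)].
Proof.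
rewrite (_ : [set _ | _] = \bigcup_(j in P)
   ([set t | (j <= g n t)%N] `\` [set t | (j.+1 <= g n t)%N])).
  by apply: bigcup_measurable => j _; apply: measurableD; exact: measurable_ge.
apply/seteqP; split=> [t Pt|t [j Pj [/= h1 /negP]]].
  by exists (g n t) => //; split => //=; rewrite ltnn.
by rewrite -leqNgt => h2; suff -> : g n t = j by [];
  apply/eqP; rewrite eqn_leq h1 h2.
Qed.

Local Definition ofnat (n j : nat) : vilenkin m := phi (j%:R / (M n)%:R).

Local Lemma g_mono n k t t' : (k <= n)%N -> g n t = g n t' -> g k t = g k t'.
Proof.
elim: n => [|n IH]; first by rewrite leqn0 => /eqP ->.
rewrite leq_eqVlt => /orP[/eqP->//|]; rewrite ltnS => kn e; apply: IH => //.
by rewrite -(gdiv n t) e gdiv.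
Qed.

Local Lemma g_ofnat n j : g n (j%:R / (M n)%:R) = j.
Proof.
rewrite /g divfK; last by rewrite pnatr_eq0 -lt0n M0.
exact: Num.Theory.natrK.
Qed.

Local Lemma phi_ofnat n t k : (k < n)%N -> phi t k = ofnat n (g n t) k.
Proof.
by move=> kn; rewrite /ofnat /phi; congr inZp;
  apply: (@g_mono n); rewrite ?g_ofnat.
Qed.

Local Lemma open_cyl (U : set (vilenkin_space m)) (x : vilenkin_space m) :
  open U -> U x -> exists n, vilenkin_I n (x : vilenkin m) `<=` U.
Proof.
move=> oU Ux; apply: contrapT => /forallNP H.
have {}H n : exists y : vilenkin m, vilenkin_I n (x : vilenkin m) y /\ ~ U y.
  have /existsNP[y /not_implyP[h1 h2]] :
      ~ forall y, vilenkin_I n (x : vilenkin m) y -> U y.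
    by move=> h; apply: (H n) => y; exact: h.
  by exists y.
have [y Hy] := choice H.
have yx : (y : nat -> vilenkin_space m) @ \oo --> x.
  apply/cvg_sup => k V [W [[B oB BW] Wx] WV].
  exists k.+1 => // n /= kn; apply: WV; rewrite -BW /=.
  have /= -> : y n k = x k by apply: (Hy n).1.
  by move: Wx; rewrite -BW.
have /yx[N _ /(_ N (leqnn _))] : nbhs x U by exact: open_nbhs_nbhs.
exact: (Hy N).2.
Qed.

Local Lemma measurable_phi : measurable_fun setT phi.
Proof.
apply: (@measurability _ _ _ _ setT phi (@open (vilenkin_space m))) => //.
move=> _ [U oU <-]; rewrite setTI.
rewrite (_ : _ @^-1` _ =
    \bigcup_n [set t | vilenkin_I n (ofnat n (g n t)) `<=` U]).
  by apply: bigcupT_measurable => n;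
    exact: (measurable_gP n [set j | vilenkin_I n (ofnat n j) `<=` U]).
apply/seteqP; split => [t Ut|t [n _ /=]].
  have [n nU] := open_cyl oU Ut; exists n => // y Hy; apply: nU => k kn.
  by rewrite (Hy _ kn) -phi_ofnat.
by apply => k kn; rewrite -phi_ofnat.
Qed.

Variable A : forall k, {set 'Z_(m k)}.
Local Fixpoint J n (j : nat) : bool :=
  if n is n'.+1 then J n' (j %/ m n')%N && ((inZp j : 'Z_(m n')) \in A n')
  else true.

Local Lemma phiJ t n : (forall k, (k < n)%N -> phi t k \in A k) <-> J n (g n t).
Proof.
elim: n => [|n IH] //=; rewrite gdiv; split.
  move=> H; apply/andP; split; last exact: H.
  by apply/IH => k kn; apply: H; rewrite (ltn_trans kn).
move=> /andP[/IH H1 H2] k; rewrite ltnS leq_eqVlt => /orP[/eqP->//|]; exact: H1.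
Qed.

Local Lemma countJ n : (\sum_(0 <= j < M n) J n j = \prod_(k < n) #|A k|)%N.
Proof.
elim: n => [|n IH]; first by rewrite big_ord0 /M /vilenkin_M big_ord0 big_nat1.
rewrite big_ord_recr MS /= big_nat_mul -IH big_distrl /=.
apply: eq_bigr => i _.
rewrite -{1}[(i * m n)%N]add0n big_addn mulSn addnK.
rewrite (eq_big_nat _ _ 
  (F2 := fun r => J n i * ((inZp r : 'Z_(m n)) \in A n))%N); last first.
  move=> r /andP[_ rm]; rewrite addnC divnMDl ?divn_small
            ?addn0 ?(ltnW (m1 n))//.
  rewrite (_ : inZp (i * m n + r) = inZp r).
    by case: (J n i); case: (_ \in _).
  by apply: val_inj; rewrite /= Zp_cast// modnMDl.
rewrite -big_distrr /=; congr muln.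
rewrite -sum1_card [RHS]big_mkcond /=.
have -> (F : nat -> nat) : (\sum_(0 <= i < m n) F i =
    \sum_(0 <= i < (Zp_trunc (m n)).+2) F i)%N by rewrite Zp_cast.
rewrite big_mkord.
by apply: eq_bigr => r _; rewrite valZpK; case: (_ \in _).
Qed.

Local Lemma lebJ n (P : nat -> bool) N :
  lebesgue_measure [set t : R | 0 <= t /\ (g n t < N)%N /\ P (g n t)] =
  ((\sum_(0 <= j < N) P j)%N%:R / (M n)%:R)%:E.
Proof.
have Mp : 0 < (M n)%:R :> R by rewrite ltr0n M0.
have mg0 Q : measurable [set t : R | 0 <= t /\ Q (g n t)].
  rewrite (_ : [set _ | _] = `[0, +oo[%classic `&` [set t | Q (g n t)]).
    by apply: measurableI => //; exact: measurable_gP.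
  by apply/seteqP; split=> t /=; rewrite in_itv/= andbT.
elim: N => [|N IH].
  rewrite big_geq// mul0r (_ : [set _ | _] = set0) ?measure0//.
  by apply/seteqP; split => // t [_ []].
rewrite big_nat_recr//= (_ : [set _ | _] =
   [set t : R | 0 <= t /\ (g n t < N)%N /\ P (g n t)] `|`
   [set t : R | 0 <= t /\ (g n t = N /\ P N)]); last first.
  apply/seteqP; split=> t /=.
    move=> [t0 []]; rewrite ltnS leq_eqVlt => /orP[/eqP e|l] p; last by left.
    by right; rewrite -e.
  by move=> [[t0 [l p]]|[t0 [-> p]]]; do !split => //; exact: leq_trans l _.
rewrite measureU.
- rewrite [X in (X + _)%E]IH natrD mulrDl EFinD; congr (_ + _)%E.
  case PN : (P N); last first.
    rewrite mul0r (_ : [set _ | _] = set0) ?measure0//.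
    by apply/seteqP; split => // t [_ []].
  transitivity (@lebesgue_measure R
    `[N%:R / (M n)%:R, N.+1%:R / (M n)%:R[%classic); last first.
    rewrite lebesgue_measure_itv/= lte_fin ltr_pM2r ?invr_gt0// ltr_nat ltnSn.
    by rewrite -EFinB -mulrBl -natrB// subSnn.
  congr lebesgue_measure; apply/seteqP; split => t /=; rewrite in_itv/=.
    move=> [t0 [e _]]; have /Num.Theory.truncn_itv : 0 <= t * (M n)%:R.
      by rewrite mulr_ge0// ltW.
    by rewrite -/(g n t) e ler_pdivrMr// ltr_pdivlMr.
  rewrite ler_pdivrMr// ltr_pdivlMr// => h; split.
    by rewrite -(pmulr_lge0 _ Mp) (le_trans _ (proj1 (andP h))).
  by split => //; exact: Num.Theory.truncn_def.
- exact: (mg0 (fun j => (j < N)%N /\ P j)).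
- exact: (mg0 (fun j => j = N /\ P N)).
- by apply/seteqP; split => // t [[_ [h _]] [_ [e _]]]; move: h; rewrite e ltnn.
Qed.

End HaarExistence.

Lemma vilenkin_haar_exists (R : realType) (m : nat -> nat) :
  (forall k, (1 < m k)%N) ->
  exists mu : {measure set (vilenkin m) -> \bar R}, vilenkin_haar mu.
Proof.
move=> m1.
have mI : measurable (`[0, 1[%classic : set R) by [].
have mphi := @measurable_phi R m m1.
exists (measure_function_pushforward__canonical__measure_function_Measure
  (mrestr lebesgue_measure mI) mphi).
move=> n A; rewrite /= /pushforward /mrestr.
transitivity (lebesgue_measure
  [set t : R | 0 <= t /\ (g m n t < vilenkin_M m n)%N /\ J A n (g m n t)]).
  congr lebesgue_measure; apply/seteqP; split => t /=; rewrite in_itv/=.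
    move=> [/(phiJ m1) h /andP[t0 t1]]; split => //; split => //.
    rewrite ltnNge g_ge ?M0// divff ?pnatr_eq0 -?lt0n ?M0//.
    by rewrite -ltNge.
  move=> [t0 [h /(phiJ m1)]]; split => //; rewrite t0/=.
  by move: h; rewrite ltnNge g_ge ?M0// divff ?pnatr_eq0 -?lt0n ?M0// -ltNge.
rewrite lebJ// countJ//; congr EFin.
by rewrite prodf_div -!natr_prod.
Qed.

Section FourierAnalysis.
Local Open Scope complex_scope.
Variables (R : realType) (m : nat -> nat).
Variable mu : {measure set (vilenkin m) -> \bar R}.
Implicit Types (f : vilenkin m -> R[i]) (D : set (vilenkin m)).

Definition Cintegrable f :=
  mu.-integrable setT (fun x => (complex.Re (f x))%:E) /\
  mu.-integrable setT (fun x => (complex.Im (f x))%:E).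

Definition Cintegral D f : R[i] :=
  (\int[mu]_(x in D) complex.Re (f x)) +i* (\int[mu]_(x in D) complex.Im (f x)).

Definition norm1 f : \bar R := (\int[mu]_x (Normc.normc (f x))%:E)%E.

Definition fourier_coef f (n : nat) : R[i] :=
  Cintegral setT (fun x => f x * conjc (vilenkin_psi R n x)).

Definition partial_sum f (n : nat) : vilenkin m -> R[i] :=
  fun x => \sum_(k < n) fourier_coef f k * vilenkin_psi R k x.

Definition log_mean f (n : nat) : vilenkin m -> R[i] :=
  fun x => (\sum_(1 <= k < n.+1) k%:R^-1)^-1 *
           \sum_(k < n) partial_sum f k x / (n - k)%:R.

Definition maximal f (x : vilenkin m) : \bar R :=
  ereal_sup [set ((fine (mu (vilenkin_I n x)))^-1 *
                  Normc.normc (Cintegral (vilenkin_I n x) f))%:E | n in setT].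

Definition hardy_norm f : \bar R := (\int[mu]_x maximal f x)%E.

(* A martingale (f_n) of H_1(G_m) is identified with the f in L_1 such that
   f_n x = (mu (I_n x))^-1 * \int_(I_n x) f.  The function maximal f is
   nonnegative, and measurable as a countable supremum of step functions. *)
Definition hardy f := Cintegrable f /\ (hardy_norm f < +oo)%E.

End FourierAnalysis.

(* Main.v *)
Require Import Defs.
From HB Require Import structures.
From mathcomp Require Import all_boot all_order all_algebra.
From mathcomp Require Import all_classical all_reals all_analysis.
From mathcomp Require Import measurable_realfun complex.
From mathcomp Require Import zify ring lra.

(* Let D_q be the sum of the first q Vilenkin functions and M_N the generalized
   powers.  The function g_N = psi_(M_N) D_(M_N) has modulus M_N on I_N(0) and 0
   elsewhere, and mean 0 on every cell of level at most N, so f = sum_k w_k g_(N_k)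
   with w_k = 2^-(k+1) satisfies f^* <= sum_k w_k |g_(N_k)|, whose integral is 1.

   The difference S_n f - S_k f has at most n - k terms, and the Fourier
   coefficients of f are at most 1, so |S_n f - L_n f| <= n / l_n pointwise.  On
   the cell I_a(0) with M_a comparable to n, the integral of this error tends
   to 0 because l_n tends to infinity: there L_n behaves like S_n.

   For n = M_N + q with q = M_a + M_(a+2) + ... + M_(a+2T) and N = a + 2T + 1, the
   new part of S_n f is w_K psi_(M_N) D_q, and |D_q| >= M_b / 2 on the set of x
   whose first nonzero coordinate has index b = a + 2s, s <= T.  This set has
   measure at least 1 / (2 M_b), so the norm of L_n f is at least a constant times
   w_K T.  The scales are chosen with T = 4^(K+2) and a large enough for the
   error and the older terms of the series to be negligible. *)

Set Implicit Arguments.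
Unset Strict Implicit.
Unset Printing Implicit Defensive.
Import Order.TTheory GRing.Theory Num.Theory numFieldNormedType.Exports.
Local Open Scope classical_set_scope.
Local Open Scope ring_scope.

(** * Roots of unity and Dirichlet kernels *)

Local Notation cnorm := Normc.normc.

Section ComplexUnit.
Local Open Scope complex_scope.
Variable R : realType.
Implicit Types (t : R) (z : R[i]) (n : nat).

Lemma cnorm_ge0 z : 0 <= cnorm z.
Proof. by case: z => a b; rewrite /= sqrtr_ge0. Qed.

Lemma cnorm_sum (I : Type) (r : seq I) (P : pred I) (F : I -> R[i]) :
  cnorm (\sum_(i <- r | P i) F i) <= \sum_(i <- r | P i) cnorm (F i).
Proof.
elim/big_rec2: _ => [|i x z _ h]; first by rewrite Normc.normc0.
by rewrite (le_trans (le_normcD _ _))// lerD2l.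
Qed.

Lemma cnorm_real t : cnorm t%:C = `|t|.
Proof. by rewrite /= expr0n addr0 sqrtr_sqr. Qed.

Lemma cnorm_nat n : cnorm (n%:R : R[i]) = n%:R.
Proof. by rewrite -[n%:R]/(1 *+ n) normcMn Normc.normc1. Qed.

Lemma cnormX z n : cnorm (z ^+ n) = cnorm z ^+ n.
Proof.
by elim: n => [|n IH]; rewrite ?expr0 ?Normc.normc1// !exprS Normc.normcM IH.
Qed.

Lemma cnorm_conj z : cnorm z^* = cnorm z.
Proof. by case: z => a b; rewrite /= sqrrN. Qed.

Lemma ler_Re_cnorm z : `|complex.Re z| <= cnorm z.
Proof.
case: z => a b /=; rewrite -sqrtr_sqr ler_wsqrtr// lerDl sqr_ge0//.
Qed.

Lemma ler_Im_cnorm z : `|complex.Im z| <= cnorm z.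
Proof.
case: z => a b /=; rewrite -sqrtr_sqr ler_wsqrtr// lerDr sqr_ge0//.
Qed.

Definition cis t : R[i] := cos t +i* sin t.

Lemma cisD s t : cis (s + t) = cis s * cis t.
Proof.
apply/eqP; rewrite eq_complex /= cosD sinD; apply/andP; split => //.
by rewrite addrC.
Qed.

Lemma cis_mulrn t n : cis (t *+ n) = cis t ^+ n.
Proof.
elim: n => [|n IH]; first by rewrite mulr0n expr0 /cis cos0 sin0.
by rewrite mulrS exprS cisD IH.
Qed.

Lemma cnorm_cis t : cnorm (cis t) = 1.
Proof. by rewrite /= cos2Dsin2 sqrtr1. Qed.

Lemma mul_conj_unit z : cnorm z = 1 -> z * z^* = 1.
Proof.
case: z => a b /= h; apply/eqP; rewrite eq_complex /=; apply/andP; split.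
  rewrite mulrN opprK -!expr2 -[X in X == _]sqr_sqrtr ?h ?expr1n//.
  by rewrite addr_ge0// sqr_ge0.
by rewrite mulrN mulrC addrC subrr.
Qed.

Definition unity_root n : R[i] := cis (2 * pi / n%:R).

Lemma unity_root_prim n : (0 < n)%N -> n.-primitive_root (unity_root n).
Proof.
move=> n0; have nR : (n%:R : R) != 0 by rewrite pnatr_eq0 -lt0n.
apply/andP; split => //; apply/forallP => -[i /= ilt]; apply/eqP.
rewrite unity_rootE /unity_root -cis_mulrn.
have [->|ni] := eqVneq i.+1 n.
  rewrite -[_ *+ n]mulr_natr divfK// mulr_natl mulr2n cisD.
  have -> : cis (pi : R) = -1.
    by apply/eqP; rewrite eq_complex /= cospi sinpi oppr0 !eqxx.
  by rewrite mulrNN mulr1 eqxx.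
(* The real part suffices: [u = pi * (i + 1) / n] lies strictly between 0 and [pi], so [sin u > 0]
   and [cos (u + u) < 1]. *)
apply/negbTE/eqP => -[h _].
have i1n : (i.+1 < n)%N by rewrite ltn_neqAle ni.
set u : R := pi / n%:R *+ i.+1.
have u2 : 2 * pi / n%:R *+ i.+1 = u + u.
  by rewrite -mulrA [2 * _]mulr_natl mulr2n mulrnDl.
have u0 : 0 < u by rewrite pmulrn_lgt0// divr_gt0 ?pi_gt0 ?ltr0n.
have upi : u < pi.
  rewrite /u -mulrnAl ltr_pdivrMr ?ltr0n// -[X in X < _]mulr_natr.
  by rewrite ltr_pM2l ?pi_gt0// ltr_nat.
have su : 0 < sin u by apply: sin_gt0_pi; rewrite u0.
move: h; rewrite u2 cosD -!expr2 => h.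
have := cos2Dsin2 u; have : 0 < sin u ^+ 2 by rewrite exprn_gt0.
lra.
Qed.

Lemma geometric_unity z n : z ^+ n = 1 -> z != 1 -> \sum_(i < n) z ^+ i = 0.
Proof.
move=> zn z1; have := subrX1 z n; rewrite zn subrr => /esym/eqP.
by rewrite mulf_eq0 subr_eq0 (negbTE z1) /= => /eqP.
Qed.

End ComplexUnit.

(** * Vilenkin functions and lower bounds for their Dirichlet kernels *)

Section VilenkinDirichlet.
Local Open Scope complex_scope.
Variables (R : realType) (m : nat -> nat).
Hypothesis m_gt1 : forall k, (1 < m k)%N.
Implicit Types (x y : vilenkin m) (n k j v q : nat).
Local Notation M := (vilenkin_M m).
Local Notation psi := (vilenkin_psi R).
Local Notation r := (rademacher R).

Lemma vilenkin_MS n : M n.+1 = (M n * m n)%N.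
Proof. by rewrite /vilenkin_M big_ord_recr. Qed.

Lemma vilenkin_M_gt0 n : (0 < M n)%N.
Proof. exact: leq_ltn_trans (vilenkin_M_ltn m_gt1 n). Qed.

Lemma vilenkin_M_dvd k n : (k <= n)%N -> (M k %| M n)%N.
Proof.
move=> /subnKC <-; elim: (n - k)%N => [|d IH]; first by rewrite addn0.
by rewrite addnS vilenkin_MS dvdn_mulr.
Qed.

Lemma vilenkin_M_le k n : (k <= n)%N -> (M k <= M n)%N.
Proof. by move=> /vilenkin_M_dvd; apply: dvdn_leq; exact: vilenkin_M_gt0. Qed.

Lemma vilenkin_M_double n : ((M n).*2 <= M n.+1)%N.
Proof. by rewrite vilenkin_MS -muln2 leq_mul2l m_gt1 orbT. Qed.

(** Indices below [M n.+1] are grouped by their top digit [v]; this is the engine of the later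
    inductions on the level. *)
Lemma sum_vilenkin_M (V : nmodType) n (F : nat -> V) :
  \sum_(j < M n.+1) F j = \sum_(v < m n) \sum_(j < M n) F (v * M n + j)%N.
Proof.
rewrite vilenkin_MS mulnC -(big_mkord predT F) big_nat_mul big_mkord.
apply: eq_bigr => v _; rewrite mulSn -{1}[(v * M n)%N]add0n big_addn addnK.
by rewrite big_mkord; apply: eq_bigr => j _; rewrite addnC.
Qed.

Lemma digit_gt n k : (n < M k)%N -> vilenkin_digit m n k = 0%N.
Proof. by move=> h; rewrite /vilenkin_digit divn_small ?mod0n. Qed.

Lemma digit_low n v j k : (k < n)%N ->
  vilenkin_digit m (v * M n + j) k = vilenkin_digit m j k.
Proof.
move=> kn; rewrite /vilenkin_digit.
have /dvdnP[c ->] := vilenkin_M_dvd kn.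
rewrite vilenkin_MS [(_ * m k)%N]mulnC !mulnA divnMDl ?vilenkin_M_gt0//.
by rewrite modnMDl.
Qed.

Lemma digit_top n v j : (j < M n)%N -> (v < m n)%N ->
  vilenkin_digit m (v * M n + j) n = v.
Proof.
move=> jn vn; rewrite /vilenkin_digit divnMDl ?vilenkin_M_gt0//.
by rewrite divn_small// addn0 modn_small.
Qed.

(** All digits of [n] from position [L] on vanish, so functions of different indices can be written
    as products over one common range. *)
Lemma psiE L n x : (n < M L)%N ->
  psi n x = \prod_(k < L) r k x ^+ vilenkin_digit m n k.
Proof.
have ext a b : (n < M a)%N -> (a <= b)%N ->
    \prod_(k < a) r k x ^+ vilenkin_digit m n k =
    \prod_(k < b) r k x ^+ vilenkin_digit m n k.
  move=> na /subnKC <-; elim: (b - a)%N => [|d IH]; first by rewrite addn0.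
  rewrite addnS big_ord_recr/= -IH digit_gt ?expr0 ?mulr1//.
  by rewrite (leq_trans na)// vilenkin_M_le// leq_addr.
move=> nL; have nn := vilenkin_M_ltn m_gt1 n; rewrite /vilenkin_psi.
have [h|/ltnW h] := leqP n L; first exact: ext.
by rewrite (ext _ _ nL h).
Qed.

Lemma rademacherE k x : r k x = unity_root R (m k) ^+ (x k : nat).
Proof. 
rewrite -cis_mulrn -[rademacher _ _ _]/(cis _); congr cis.
by rewrite -[RHS]mulr_natr [RHS]mulrAC.
Qed.

Lemma Zm_lt k x : ((x k : nat) < m k)%N.
Proof. by rewrite -[X in (_ < X)%N](Zp_cast (m_gt1 k)). Qed.

Lemma rademacher_expm k x : r k x ^+ m k = 1.
Proof.
rewrite rademacherE -exprM mulnC exprM.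
by rewrite (prim_expr_order (unity_root_prim R _)) ?expr1n// ltnW.
Qed.

Lemma rademacher_eq1 k x : (r k x == 1) = (x k == 0).
Proof.
rewrite rademacherE -[1](expr0 (unity_root R (m k))).
rewrite (eq_prim_root_expr (unity_root_prim R _)); last by rewrite ltnW.
by rewrite eqn_mod_dvd// subn0 /dvdn modn_small ?Zm_lt.
Qed.

Lemma cnorm_rademacher k x : cnorm (r k x) = 1.
Proof. by rewrite cnorm_cis. Qed.

Lemma cnorm_psi n x : cnorm (psi n x) = 1.
Proof.
rewrite /vilenkin_psi; elim/big_rec: _ => [|k z _ h]; first exact: Normc.normc1.
by rewrite Normc.normcM h cnormX cnorm_rademacher expr1n mulr1.
Qed.

Lemma psi_split n v j x : (j < M n)%N -> (v < m n)%N ->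
  psi (v * M n + j) x = r n x ^+ v * psi j x.
Proof.
move=> jn vn; rewrite (psiE _ jn) (@psiE n.+1); last first.
  rewrite vilenkin_MS (leq_trans (_ : _ < v * M n + M n)%N) ?ltn_add2l//.
  by rewrite -mulSnr mulnC leq_mul2l vn orbT.
rewrite big_ord_recr /= digit_top// mulrC; congr (_ * _).
by apply: eq_bigr => k _; rewrite digit_low.
Qed.

Lemma psi_local n j x y : (j < M n)%N -> vilenkin_I n x y -> psi j y = psi j x.
Proof.
move=> jn xy; rewrite !(psiE _ jn); apply: eq_bigr => k _.
by rewrite !rademacherE xy.
Qed.

Lemma psi_I0 n j x : (j < M n)%N -> vilenkin_I n (fun=> 0) x -> psi j x = 1.
Proof.
move=> jn x0; rewrite (psiE _ jn) big1// => k _.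
by have /eqP-> : r k x == 1; [rewrite rademacher_eq1 x0|rewrite expr1n].
Qed.

Definition dirichlet q x : R[i] := \sum_(j < q) psi j x.

Lemma dirichlet_I0 n q x : (q <= M n)%N -> vilenkin_I n (fun=> 0) x ->
  dirichlet q x = q%:R.
Proof.
move=> qn x0; rewrite /dirichlet (eq_bigr (fun=> 1)).
  by rewrite sumr_const card_ord.
by move=> j _; rewrite (psi_I0 _ x0)// (leq_trans _ qn).
Qed.

(** Grouping by the top digit factors the kernel of order [M n.+1] as the sum of the powers of
    [r n x] times the kernel of order [M n]. The geometric sum vanishes if [x n] is nonzero; an
    earlier nonzero coordinate is left to the induction. *)
Lemma dirichlet_out n k x : (k < n)%N -> x k != 0 -> dirichlet (M n) x = 0.
Proof.
elim: n => // n IH kn xk.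
rewrite /dirichlet (sum_vilenkin_M n (fun j => psi j x)).
transitivity (\sum_(v < m n) r n x ^+ v * dirichlet (M n) x).
  apply: eq_bigr => v _; rewrite /dirichlet big_distrr/=.
  by apply: eq_bigr => j _; rewrite psi_split.
rewrite -big_distrl /=; move: kn; rewrite ltnS leq_eqVlt => /orP[/eqP kn|kn].
  by rewrite geometric_unity ?mul0r ?rademacher_expm// rademacher_eq1 -kn.
by rewrite IH ?mulr0.
Qed.

(** The indices [M n + j] with [j < q] have digit 1 in position [n], so their functions are
    [r n * psi j]. *)
Lemma dirichletD n q x : (q <= M n)%N ->
  dirichlet (M n + q) x = dirichlet (M n) x + r n x * dirichlet q x.
Proof.
move=> qn; rewrite /dirichlet big_split_ord /=; congr (_ + _).
rewrite big_distrr /=; apply: eq_bigr => j _.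
by rewrite -{1}[M n]mul1n psi_split// (leq_trans _ qn).
Qed.

Lemma cnorm_dirichlet q x : cnorm (dirichlet q x) <= q%:R.
Proof.
rewrite (le_trans (cnorm_sum _ _ _))// (eq_bigr (fun=> 1)).
  by rewrite sumr_const card_ord.
by move=> j _; rewrite cnorm_psi.
Qed.

Fixpoint lacunary a T : nat :=
  if T is T'.+1 then (M (a + T.*2) + lacunary a T')%N else M a.

Lemma lacunary_le a T : (lacunary a T <= (M (a + T.*2)).*2)%N.
Proof.
elim: T => [|T IH] /=; first by rewrite addn0 -[X in (_ <= X)%N]addnn leq_addl.
rewrite -[X in (_ <= X)%N]addnn leq_add2l (leq_trans IH)//.
rewrite (leq_trans (vilenkin_M_double _))//.
by apply: vilenkin_M_le; rewrite -addnS leq_add2l.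
Qed.

(** The gap of two between the exponents makes the terms so far at most half of the next power, so
    the next kernel dominates. *)
Lemma lacunary_le2 a T : ((lacunary a T).*2 <= M (a + T.+1.*2))%N.
Proof.
rewrite doubleS !addnS (leq_trans _ (vilenkin_M_double _))// leq_double.
by rewrite (leq_trans (lacunary_le a T))// vilenkin_M_double.
Qed.

Lemma lacunary_le1 a T : (lacunary a T <= M (a + T.*2).+1)%N.
Proof. exact: leq_trans (lacunary_le a T) (vilenkin_M_double _). Qed.

Definition first_nonzero b : set (vilenkin m) :=
  [set x | vilenkin_I b (fun=> 0) x /\ x b != 0].

(** Induction on [T], splitting off the leading power. If [s] is below the leading position, the
    leading kernel vanishes at [x] and the modulus passes to the shorter sum. If [s] is the leading
    position, that kernel equals its order at [x], and the rest takes away at most half of it. *)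
Lemma dirichlet_lacunary_ge a T s x : (s <= T)%N -> first_nonzero (a + s.*2) x ->
  (M (a + s.*2))%:R / 2 <= cnorm (dirichlet (lacunary a T) x).
Proof.
move=> + [x0 xs]; elim: T => [|T IH].
  rewrite leqn0 => /eqP s0; move: x0; rewrite s0 addn0 /= => x0.
  rewrite (dirichlet_I0 _ x0)// cnorm_nat ler_pdivrMr// ler_peMr//.
  by rewrite ler1n.
rewrite [lacunary a T.+1]/(M (a + T.+1.*2) + lacunary a T)%N.
rewrite leq_eqVlt => /orP[/eqP e|sT].
  move: x0 xs; rewrite e => x0 xs; rewrite dirichletD; last first.
    by rewrite (leq_trans _ (lacunary_le2 a T))// -addnn leq_addr.
  rewrite (dirichlet_I0 _ x0)//.
  set z := r _ _ * _.
  have := le_normcD ((M (a + T.+1.*2))%:R + z) (- z).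
  rewrite addrK normcN /z Normc.normcM cnorm_rademacher mul1r cnorm_nat.
  have := cnorm_dirichlet (lacunary a T) x.
  have : ((lacunary a T).*2)%:R <= (M (a + T.+1.*2))%:R :> R.
    by rewrite ler_nat lacunary_le2.
  rewrite -mul2n natrM; lra.
rewrite dirichletD; last first.
  by rewrite (leq_trans _ (lacunary_le2 a T))// -addnn leq_addr.
rewrite (dirichlet_out _ xs) ?add0r; last by rewrite ltn_add2l ltn_double.
by rewrite Normc.normcM cnorm_rademacher mul1r IH.
Qed.

End VilenkinDirichlet.

(** * Cells and step functions *)

Section Cells.
Local Open Scope complex_scope.
Variables (R : realType) (m : nat -> nat).
Hypothesis m_gt1 : forall k, (1 < m k)%N.
Implicit Types (x y : vilenkin m) (n k j v : nat).
Local Notation M := (vilenkin_M m).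
Local Notation psi := (vilenkin_psi R).
Local Notation r := (rademacher R).

(** For [j < M n] these points represent each cell of level [n] exactly once, by [cell_point_ex] and
    [cell_point_inj]. *)
Definition cell_point j : vilenkin m := fun k => inZp (vilenkin_digit m j k).
Local Notation pt := cell_point.

Lemma cell_point_val j k : (pt j k : nat) = vilenkin_digit m j k.
Proof. by rewrite /cell_point /= Zp_cast// /vilenkin_digit modn_mod. Qed.

Lemma cell_point_low n v j : vilenkin_I n (pt j) (pt (v * M n + j)).
Proof. by move=> k kn; apply: ord_inj; rewrite !cell_point_val digit_low. Qed.

Lemma vilenkin_I_sym n x y : vilenkin_I n x y -> vilenkin_I n y x.
Proof. by move=> xy k kn; rewrite xy. Qed.

Lemma vilenkin_I_trans n x y z :
  vilenkin_I n x y -> vilenkin_I n y z -> vilenkin_I n x z.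
Proof. by move=> xy yz k kn; rewrite yz// xy. Qed.

Lemma vilenkin_I_le n n' x : (n <= n')%N -> vilenkin_I n' x `<=` vilenkin_I n x.
Proof. by move=> nn y h k kn; apply: h; exact: leq_trans kn nn. Qed.

Lemma vilenkin_M_split n j : (j < M n.+1)%N ->
  exists v i, [/\ (v < m n)%N, (i < M n)%N & j = (v * M n + i)%N].
Proof.
move=> jn; exists (j %/ M n)%N, (j %% M n)%N; split; last exact: divn_eq.
  by rewrite ltn_divLR ?vilenkin_M_gt0// mulnC -vilenkin_MS.
by rewrite ltn_mod vilenkin_M_gt0.
Qed.

Lemma vilenkin_M_merge n v i :
  (v < m n)%N -> (i < M n)%N -> (v * M n + i < M n.+1)%N.
Proof.
move=> vn iM; rewrite vilenkin_MS (leq_trans (_ : _ < v * M n + M n)%N) ?ltn_add2l//.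
by rewrite -mulSnr mulnC leq_mul2l vn orbT.
Qed.

Lemma cell_point_ex n x : exists2 j, (j < M n)%N & vilenkin_I n (pt j) x.
Proof.
elim: n => [|n [j jn jx]]; first by exists 0%N => //; exact: vilenkin_M_gt0.
exists ((x n : nat) * M n + j)%N; first by rewrite vilenkin_M_merge// Zm_lt.
move=> k; rewrite ltnS leq_eqVlt => /orP[/eqP ->|kn].
  by apply: ord_inj; rewrite cell_point_val digit_top// Zm_lt.
by rewrite jx// cell_point_low.
Qed.

Lemma cell_point_inj n i j : (i < M n)%N -> (j < M n)%N ->
  vilenkin_I n (pt i) (pt j) -> i = j.
Proof.
elim: n i j => [|n IH] i j.
  by rewrite /vilenkin_M big_ord0; case: i => //; case: j.
move=> /vilenkin_M_split[v [i' [vn i'n ->]]].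
move=> /vilenkin_M_split[w [j' [wn j'n ->]]] h.
congr (_ * _ + _)%N.
  have /(congr1 (@nat_of_ord _)) := h n (ltnSn n); rewrite !cell_point_val.
  by rewrite !digit_top.
apply: IH => //; apply: vilenkin_I_trans (cell_point_low v i') _.
apply: vilenkin_I_trans (vilenkin_I_sym (cell_point_low w j')).
by apply: vilenkin_I_le h.
Qed.

Definition step (T : Type) n (h : vilenkin m -> T) :=
  forall x y, vilenkin_I n x y -> h x = h y.

Lemma step_le (T : Type) n n' (h : vilenkin m -> T) :
  (n <= n')%N -> step n h -> step n' h.
Proof. by move=> nn hs x y /(vilenkin_I_le nn); exact: hs. Qed.

Lemma step_comp (T T' : Type) n (h : vilenkin m -> T) (g : T -> T') :
  step n h -> step n (fun x => g (h x)).
Proof. by move=> hs x y /hs ->. Qed.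

Lemma step_comp2 (T1 T2 T' : Type) n (h1 : vilenkin m -> T1)
    (h2 : vilenkin m -> T2) (g : T1 -> T2 -> T') :
  step n h1 -> step n h2 -> step n (fun x => g (h1 x) (h2 x)).
Proof. by move=> s1 s2 x y xy; rewrite (s1 _ _ xy) (s2 _ _ xy). Qed.

Lemma step_indic n x : step n (\1_(vilenkin_I n x) : vilenkin m -> R).
Proof.
move=> y z yz; rewrite !indicE; congr (_ %:R); congr nat_of_bool.
apply/idP/idP; rewrite !inE => h; first exact: vilenkin_I_trans h yz.
exact: vilenkin_I_trans h (vilenkin_I_sym yz).
Qed.

Lemma step_psi n j : (j < M n)%N -> step n (psi j : vilenkin m -> R[i]).
Proof. by move=> jn x y /(psi_local R m_gt1 jn) ->. Qed.

Lemma step_rademacher n : step n.+1 (r n : vilenkin m -> R[i]).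
Proof. by move=> x y xy; rewrite !rademacherE xy. Qed.

Lemma step_bigsum (V : nmodType) (I : Type) (s : seq I) (P : pred I) n
    (h : I -> vilenkin m -> V) : (forall i, P i -> step n (h i)) ->
  step n (fun x => \sum_(i <- s | P i) h i x).
Proof. by move=> hs x y xy; apply: eq_bigr => i Pi; exact: hs. Qed.

Lemma step_sum_cells n (h : vilenkin m -> R) x : step n h ->
  h x = \sum_(j < M n) h (pt j) * \1_(vilenkin_I n (pt j)) x.
Proof.
move=> hs; have [i iM ix] := cell_point_ex n x.
rewrite (bigD1 (Ordinal iM))//= big1 ?addr0 => [|j /negP ji].
  by rewrite indicE mem_set// mulr1; apply/esym/hs.
rewrite indicE memNset ?mulr0// => jx; apply: ji; apply/eqP/val_inj => /=.
apply: (@cell_point_inj n) => //.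
exact: vilenkin_I_trans jx (vilenkin_I_sym ix).
Qed.

(** On functions constant on the cells of level [n] this is the Haar integral ([step_Cintegral]), so
    orthogonality becomes finite algebra. *)
Definition cell_avg n (h : vilenkin m -> R[i]) : R[i] :=
  (M n)%:R^-1 * \sum_(j < M n) h (pt j).

Lemma rademacher_cell_point n v j : (j < M n)%N -> (v < m n)%N ->
  r n (pt (v * M n + j)) = unity_root R (m n) ^+ v.
Proof. by move=> jn vn; rewrite rademacherE cell_point_val digit_top. Qed.

(** As [h] ignores coordinate [n], the sum factors through the sum of all [m n]-th roots of unity,
    which is zero. *)
Lemma cell_avg_rademacher n (h : vilenkin m -> R[i]) :
  step n h -> cell_avg n.+1 (fun x => h x * r n x) = 0.
Proof.
move=> hs; rewrite /cell_avg (sum_vilenkin_M m n (fun j => h (pt j) * r n (pt j))).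
have -> : \sum_(v < m n) \sum_(j < M n)
      h (pt (v * M n + j)) * r n (pt (v * M n + j)) =
    (\sum_(v < m n) unity_root R (m n) ^+ v) * \sum_(j < M n) h (pt j).
  rewrite big_distrl; apply: eq_bigr => v _; rewrite big_distrr.
  apply: eq_bigr => j _; rewrite rademacher_cell_point// mulrC; congr (_ * _).
  by apply/esym/hs/cell_point_low.
have prim := unity_root_prim R (ltnW (m_gt1 n)).
rewrite geometric_unity ?mul0r ?mulr0 ?(prim_expr_order prim)//.
rewrite -[X in X != _]expr1 -[X in _ != X](expr0 (unity_root R (m n))).
by rewrite (eq_prim_root_expr prim) mod0n modn_small.
Qed.

(** Orthonormality, by induction on the level. The top digits [v] and [w] contribute a geometric sum
    of ratio [z]: equal digits give [z = 1], distinct ones a root of unity other than 1, whose sum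
    vanishes. *)
Lemma cell_avg_psi n i j : (i < M n)%N -> (j < M n)%N ->
  cell_avg n (fun x => psi i x * (psi j x)^*) = (i == j)%:R.
Proof.
(* The normalization is removed first, because the unnormalized sums are the ones that factor from
   one level to the next. *)
move=> iM jM; suff -> : cell_avg n (fun x => psi i x * (psi j x)^*) =
    (M n)%:R^-1 * ((i == j)%:R * (M n)%:R).
  by rewrite mulrC mulfK// pnatr_eq0 -lt0n vilenkin_M_gt0.
congr (_ * _); elim: n i j iM jM => [|n IH] i j.
  rewrite /vilenkin_M big_ord0; case: i => //; case: j => // _ _.
  rewrite big_ord1 /vilenkin_psi !big_ord0; by rewrite rmorph1 !mulr1.
move=> /vilenkin_M_split[v [i' [vn i'n ->]]].
move=> /vilenkin_M_split[w [j' [wn j'n ->]]].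
rewrite (sum_vilenkin_M m n (fun l => psi (v * M n + i') (pt l) *
  (psi (w * M n + j') (pt l))^*)).
pose om := unity_root R (m n); pose z := om ^+ v * (om ^+ w)^*.
have prim : (m n).-primitive_root om by exact: unity_root_prim (ltnW _).
have omw : om ^+ w * (om ^+ w)^* = 1.
  by apply: mul_conj_unit; rewrite cnormX cnorm_cis expr1n.
have omv : om ^+ v * (om ^+ v)^* = 1.
  by apply: mul_conj_unit; rewrite cnormX cnorm_cis expr1n.
transitivity ((\sum_(u < m n) z ^+ u) *
    \sum_(l < M n) psi i' (pt l) * (psi j' (pt l))^*).
  rewrite big_distrl; apply: eq_bigr => u _; rewrite big_distrr.
  apply: eq_bigr => l _; rewrite !psi_split// rademacher_cell_point//.
  have <- := step_psi i'n (cell_point_low u l).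
  have <- := step_psi j'n (cell_point_low u l).
  rewrite rmorphM /z exprMn /= -!exprM -rmorphXn /= -!exprM.
  by rewrite ![(u * _)%N]mulnC mulrACA.
rewrite IH//; have [vw|vw] := eqVneq v w.
  have -> : z = 1 by rewrite /z vw.
  rewrite (eq_bigr (fun=> 1)) => [|u _]; last by rewrite expr1n.
  rewrite sumr_const card_ord vw eqn_add2l vilenkin_MS natrM.
  by rewrite mulrCA [in X in _ * X]mulrC.
rewrite geometric_unity ?mul0r.
- have [e|//] := eqVneq; last by rewrite mul0r.
  have : vilenkin_digit m (v * M n + i') n = vilenkin_digit m (w * M n + j') n.
    by rewrite e.
  by rewrite !digit_top// => /eqP; rewrite (negbTE vw).
- rewrite /z exprMn -rmorphXn /= -!exprM ![(_ * m n)%N]mulnC !exprM.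
  by rewrite !(prim_expr_order prim) !expr1n rmorph1 mulr1.
apply/eqP => z1; have : om ^+ v == om ^+ w.
  by rewrite -[X in X == _]mulr1 -omw mulrCA -/z z1 mulr1.
by rewrite (eq_prim_root_expr prim) !modn_small// (negbTE vw).
Qed.

End Cells.

(** * The Haar integral of step functions *)

Section HaarIntegral.
Local Open Scope complex_scope.
Variables (R : realType) (m : nat -> nat).
Hypothesis m_gt1 : forall k, (1 < m k)%N.
Variable mu : {measure set (vilenkin m) -> \bar R}.
Hypothesis mu_haar : vilenkin_haar mu.
Implicit Types (x y : vilenkin m) (n k j v : nat).
Local Notation M := (vilenkin_M m).
Local Notation pt := (@cell_point m).

(** Every subset of a discrete factor is open and projections are continuous, so the set is open,
    hence Borel. *)
Lemma measurable_coord k (P : set 'Z_(m k)) :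
  measurable [set x : vilenkin m | P (x k)].
Proof.
apply: sub_sigma_algebra.
pose K k := discrete_topology 'Z_(m k).
have o : open (P : set (K k)) by exact: discrete_open.
have c := @proj_continuous nat K k.
exact: (iffLR (@continuousP (prod_topology K) (K k) (proj k)) c P o).
Qed.

Lemma measurable_vilenkin_I n x : measurable (vilenkin_I n x).
Proof.
rewrite (_ : vilenkin_I n x =
    \bigcap_(k in [set k | (k < n)%N]) [set y : vilenkin m | y k = x k]).
  by apply: bigcap_measurableType => k _; exact: (measurable_coord [set x k]).
by apply/seteqP; split => y.
Qed.

Lemma mu_setT : mu setT = 1%E.
Proof.
have := mu_haar 0 (fun=> [set 0]%SET); rewrite big_ord0 => <-; congr (mu _).
by apply/seteqP; split.
Qed.

Lemma natr_M n : \prod_(k < n) (1%:R / (m k)%:R) = (M n)%:R^-1 :> R.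
Proof.
rewrite prodf_div big1 => [|k _]; last by [].
by rewrite div1r /vilenkin_M -natr_prod.
Qed.

Lemma mu_vilenkin_I n x : mu (vilenkin_I n x) = ((M n)%:R^-1)%:E.
Proof.
rewrite -natr_M; have := mu_haar n (fun k => [set x k]%SET).
under eq_bigr => k _ do rewrite cards1.
by move=> <-; congr (mu _); apply/seteqP; split => y h k /h;
  rewrite inE => /eqP.
Qed.

Lemma measurable_first_nonzero b : measurable (@first_nonzero m b).
Proof.
rewrite (_ : first_nonzero b =
   vilenkin_I b (fun=> 0) `&` [set x : vilenkin m | x b != 0]).
  apply: measurableI; first exact: measurable_vilenkin_I.
  exact: (measurable_coord [set v | v != 0]).
by apply/seteqP; split => y.
Qed.

(** The measure is exactly [(m b - 1) / (M b * m b)], and [m b - 1] is at least half of [m b]. *)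
Lemma mu_first_nonzero b :
  (((2 * (M b)%:R)^-1)%:E <= mu (@first_nonzero m b))%E.
Proof.
have := mu_haar b.+1 (fun k => if (k < b)%N then [set 0]%SET else [set~ 0]%SET).
rewrite big_ord_recr /= ltnn cardsC1 card_ord.
rewrite (Zp_cast (m_gt1 b)).
under eq_bigr => k _ do rewrite ltn_ord cards1.
rewrite natr_M => e.
rewrite (_ : first_nonzero b = [set x | forall k, (k < b.+1)%N ->
   x k \in (if (k < b)%N then [set 0]%SET else [set~ 0]%SET)]); last first.
  apply/seteqP; split => y.
    move=> [y0 yb] k; rewrite ltnS leq_eqVlt => /orP[/eqP ->|kb].
      by rewrite ltnn !inE.
    by rewrite kb inE y0.
  move=> h; split; last by have := h b (ltnSn b); rewrite ltnn !inE.
  by move=> k kb; have := h k (ltnW kb); rewrite kb inE => /eqP.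
rewrite e lee_fin invfM mulrC ler_pM2l ?invr_gt0 ?ltr0n ?vilenkin_M_gt0//.
have mb := m_gt1 b; rewrite ler_pdivlMr ?ltr0n ?(ltnW mb)//.
rewrite mulrC ler_pdivrMr// -natrM ler_nat; lia.
Qed.

Lemma step_measurable n (h : vilenkin m -> R) :
  step n h -> measurable_fun setT h.
Proof.
move=> hs.
rewrite (_ : h = fun x => \sum_(j < M n) h (pt j) * \1_(vilenkin_I n (pt j)) x).
  apply: measurable_sum => j; apply: measurable_funM => //.
  by apply: measurable_indic; exact: measurable_vilenkin_I.
by apply/funext => x; exact: step_sum_cells.
Qed.

Lemma indic_integrable n x :
  mu.-integrable setT (fun y => (\1_(vilenkin_I n x) y)%:E : \bar R).
Proof.
apply: measurable_bounded_integrable => //.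
- by rewrite mu_setT ltry.
- by apply: measurable_indic; exact: measurable_vilenkin_I.
- exists 1; split => // c c1 y _ /=; rewrite indicE.
  by case: (y \in _); rewrite /= ?normr1 ?normr0 ltW// (lt_trans ltr01).
Qed.

Lemma step_EFin n (h : vilenkin m -> R) : step n h -> EFin \o h =
  fun x => (\sum_(j < M n) (h (pt j))%:E * (\1_(vilenkin_I n (pt j)) x)%:E)%E.
Proof.
move=> hs; apply/funext => x /=; rewrite {1}(step_sum_cells m_gt1 x hs) -sumEFin.
by apply: eq_bigr => j _; rewrite EFinM.
Qed.

(** A step function is the combination of the indicators of its [M n] cells, each of measure
    [1 / M n]. *)
Lemma step_integral n (h : vilenkin m -> R) : step n h ->
  (\int[mu]_x (h x)%:E = ((M n)%:R^-1 * \sum_(j < M n) h (pt j))%:E)%E.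
Proof.
move=> hs; rewrite -[LHS]/(integral mu setT (EFin \o h)) (step_EFin hs).
rewrite integral_sum//; last first.
  by move=> j; apply: integrableZl => //; exact: indic_integrable.
rewrite mulrC big_distrl /= -sumEFin; apply: eq_bigr => j _.
rewrite integralZl//; last exact: indic_integrable.
rewrite integral_indic//; last exact: measurable_vilenkin_I.
by rewrite setIT mu_vilenkin_I EFinM.
Qed.

Lemma Re_sum (I : Type) (s : seq I) (P : pred I) (F : I -> R[i]) :
  complex.Re (\sum_(i <- s | P i) F i) = \sum_(i <- s | P i) complex.Re (F i).
Proof. by elim/big_rec2: _ => // i x [a b] _ <-; case: (F i). Qed.

Lemma Im_sum (I : Type) (s : seq I) (P : pred I) (F : I -> R[i]) :
  complex.Im (\sum_(i <- s | P i) F i) = \sum_(i <- s | P i) complex.Im (F i).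
Proof. by elim/big_rec2: _ => // i x [a b] _ <-; case: (F i). Qed.

Lemma step_Cintegral n (h : vilenkin m -> R[i]) :
  step n h -> Cintegral mu setT h = cell_avg n h.
Proof.
move=> hs; rewrite /cell_avg.
have -> : (M n)%:R^-1 = ((M n)%:R^-1)%:C :> R[i].
  by rewrite fmorphV rmorph_nat.
apply/eqP; rewrite eq_complex /Cintegral /Rintegral /=.
rewrite (step_integral (step_comp (@complex.Re R) hs)).
rewrite (step_integral (step_comp (@complex.Im R) hs)) /=.
rewrite -Re_sum -Im_sum; case: (\sum_(j < M n) h (pt j)) => a b /=.
by rewrite !mul0r subr0 addr0 !eqxx.
Qed.

End HaarIntegral.

(** * The blocks psi_(M_n) D_(M_n) *)

(** The integral of a nonnegative function is a supremum over the simple functions below it. This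
    gives monotonicity for arbitrary functions, such as [maximal mu f]. *)
Lemma ge0_integral_mono d (T : measurableType d) (R : realType)
    (mu : {measure set T -> \bar R}) (f g : T -> \bar R) :
  (forall x, 0 <= f x)%E -> (forall x, f x <= g x)%E ->
  (\int[mu]_x f x <= \int[mu]_x g x)%E.
Proof.
move=> f0 fg; have g0 x : (0 <= g x)%E by exact: le_trans (f0 x) (fg x).
rewrite !ge0_integralTE//; apply: ereal_sup_le => _ [h hf <-].
by exists h => // x; exact: le_trans (hf x) (fg x).
Qed.

Section Blocks.
Local Open Scope complex_scope.
Variables (R : realType) (m : nat -> nat).
Hypothesis m_gt1 : forall k, (1 < m k)%N.
Variable mu : {measure set (vilenkin m) -> \bar R}.
Hypothesis mu_haar : vilenkin_haar mu.
Implicit Types (x y : vilenkin m) (n k j v : nat).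
Local Notation M := (vilenkin_M m).
Local Notation psi := (vilenkin_psi R).
Local Notation r := (rademacher R).
Local Notation D := (dirichlet R).

Definition block n x : R[i] := r n x * D (M n) x.

Lemma block_sum n x : block n x = \sum_(i < M n) psi (M n + i) x.
Proof.
rewrite /block /dirichlet big_distrr; apply: eq_bigr => i _.
by rewrite -{2}[M n]mul1n psi_split.
Qed.

Lemma vilenkin_I0P n x : ~ vilenkin_I n (fun=> 0) x ->
  exists2 k, (k < n)%N & x k != 0.
Proof.
move=> /existsNP[k /not_implyP[kn /eqP xk]]; by exists k.
Qed.

Lemma cnorm_block n x :
  cnorm (block n x) = (M n)%:R * \1_(vilenkin_I n (fun=> 0)) x.
Proof.
rewrite Normc.normcM cnorm_rademacher mul1r indicE.
have [x0|/[dup] x0 /vilenkin_I0P[k kn xk]] := pselect (vilenkin_I n (fun=> 0) x).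
  by rewrite mem_set// mulr1 (dirichlet_I0 _ _ _ x0)// cnorm_nat.
by rewrite memNset// mulr0 (dirichlet_out _ _ kn xk)// Normc.normc0.
Qed.

Lemma cnorm_block_le n x : cnorm (block n x) <= (M n)%:R.
Proof.
by rewrite cnorm_block ler_piMr// indicE; case: (_ \in _).
Qed.

Lemma step_dirichlet n q : (q <= M n)%N -> step n (D q : vilenkin m -> R[i]).
Proof.
move=> qn; apply: step_bigsum => j _; apply: step_psi => //.
exact: leq_trans (ltn_ord j) qn.
Qed.

Lemma step_block n : step n.+1 (block n).
Proof.
apply: (step_comp2 (@GRing.mul _)); first exact: step_rademacher.
by apply: (@step_le _ _ n) => //; exact: step_dirichlet.
Qed.

Lemma step_Cintegral_sum (I : Type) (s : seq I) n (a : I -> R[i])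
    (h : I -> vilenkin m -> R[i]) : (forall i, step n (h i)) ->
  Cintegral mu setT (fun x => \sum_(i <- s) a i * h i x) =
  \sum_(i <- s) a i * Cintegral mu setT (h i).
Proof.
move=> hs; rewrite (step_Cintegral m_gt1 mu_haar (n := n)); last first.
  by apply: step_bigsum => i _; exact: (step_comp (fun z => a i * z)).
rewrite /cell_avg exchange_big big_distrr /=; apply: eq_bigr => i _.
rewrite (step_Cintegral m_gt1 mu_haar (hs i)) /cell_avg mulrCA.
by rewrite -big_distrr.
Qed.

(** By orthonormality, the spectrum of the block is the interval of indices from [M n] to
    [2 * M n - 1], with all coefficients 1. *)
Lemma block_coef n j :
  Cintegral mu setT (fun x => block n x * (psi j x)^*) =
  ((M n <= j < (M n).*2)%N)%:R.
Proof.
(* A level at which [psi j] and all the functions of the block are step functions. *)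
pose L := maxn n.+1 j.
have jL : (j < M L)%N.
  exact: leq_ltn_trans (leq_maxr _ _) (vilenkin_M_ltn m_gt1 L).
have nL : (M n.+1 <= M L)%N by rewrite vilenkin_M_le// leq_maxl.
have iL i : (i < M n)%N -> (M n + i < M L)%N.
  move=> iM; rewrite (leq_trans _ nL)// (leq_trans _ (vilenkin_M_double m_gt1 n))//.
  by rewrite -addnn ltn_add2l.
have -> : (fun x => block n x * (psi j x)^*) =
    (fun x => \sum_(i < M n) 1 * (psi (M n + i) x * (psi j x)^*)).
  apply/funext => x; rewrite block_sum big_distrl.
  by apply: eq_bigr => i _; rewrite mul1r.
rewrite (@step_Cintegral_sum _ _ L); last first.
  move=> i; apply: (step_comp2 (fun z1 z2 => z1 * z2^*)); apply: step_psi => //.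
  exact: iL.
under eq_bigr => i _.
  rewrite mul1r (step_Cintegral m_gt1 mu_haar (n := L)); last first.
    apply: (step_comp2 (fun z1 z2 => z1 * z2^*)); apply: step_psi => //.
    exact: iL.
  rewrite cell_avg_psi ?iL//; over.
have [jn|jn] /= := leqP (M n) j; last first.
  by rewrite big1// => i _; rewrite gtn_eqF// (leq_trans jn)// leq_addr.
have [j2|j2] := ltnP j (M n).*2; last first.
  by rewrite big1// => i _; rewrite ltn_eqF// (leq_trans _ j2)// -addnn ltn_add2l.
have jMn : (j - M n < M n)%N by rewrite ltn_subLR// addnn.
rewrite (bigD1 (Ordinal jMn))//= subnKC// eqxx big1 ?addr0// => i /negP h.
case: eqVneq => // e; exfalso; apply: h; apply/eqP/val_inj => /=.
by rewrite -e addKn.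
Qed.

(** With the indicator as a factor, integrals over cells and Fourier coefficients both become
    integrals of [f * h] for a step function [h], and one limit argument serves for both. *)
Lemma Cintegral_restrict (E : set (vilenkin m)) (f : vilenkin m -> R[i]) :
  Cintegral mu E f = Cintegral mu setT (fun x => f x * (\1_E x : R)%:C).
Proof.
rewrite /Cintegral Rintegral_mkcond [X in _ +i* X]Rintegral_mkcond.
have e x : f x * (\1_E x : R)%:C = if x \in E then f x else 0.
  by rewrite indicE; case: ifP => _; rewrite /= ?mulr1 ?mulr0.
by congr (_ +i* _); apply: eq_Rintegral => x _; rewrite e patchE; case: ifP.
Qed.

(** The kernel of order [M N] and the indicator depend only on the coordinates below [N], so the
    remaining factor [r N] averages to zero. *)
Lemma block_martingale n N x : (n <= N)%N ->
  Cintegral mu setT (fun y => block N y * (\1_(vilenkin_I n x) y : R)%:C) = 0.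
Proof.
move=> nN.
have s : step N (fun y => D (M N) y * (\1_(vilenkin_I n x) y : R)%:C).
  apply: (step_comp2 (fun z1 z2 => z1 * z2%:C)); first exact: step_dirichlet.
  by apply: (step_le nN); exact: step_indic.
have e y : block N y * (\1_(vilenkin_I n x) y : R)%:C =
    D (M N) y * (\1_(vilenkin_I n x) y : R)%:C * r N y.
  by rewrite /block mulrC mulrA mulrAC [_ * D _ _]mulrC.
rewrite (_ : (fun y => _) =
    fun y => D (M N) y * (\1_(vilenkin_I n x) y : R)%:C * r N y); last first.
  by apply/funext.
rewrite (step_Cintegral m_gt1 mu_haar (n := N.+1)); last first.
  apply: (step_comp2 (@GRing.mul _)); last exact: step_rademacher.
  exact: step_le s.
exact: cell_avg_rademacher.
Qed.

Lemma block_cst n N x : (N < n)%N ->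
  Cintegral mu setT (fun y => block N y * (\1_(vilenkin_I n x) y : R)%:C) =
  block N x * (M n)%:R^-1.
Proof.
move=> Nn.
(* The one-term sum brings the integrand into the form required by [step_Cintegral_sum]. *)
have -> : (fun y => block N y * (\1_(vilenkin_I n x) y : R)%:C) =
    fun y => \sum_(i <- [:: tt]) block N x * (\1_(vilenkin_I n x) y : R)%:C.
  apply/funext => y; rewrite big_seq1 indicE.
  have [xy|xy] := pselect (vilenkin_I n x y); last first.
    by rewrite memNset// !mulr0.
  by rewrite mem_set// (step_block (vilenkin_I_le Nn xy)).
rewrite (@step_Cintegral_sum _ _ n); last first.
  by move=> _; apply: (step_comp (fun z : R => z%:C)); exact: step_indic.
rewrite big_seq1; congr (_ * _); apply/eqP; rewrite eq_complex /=.
rewrite /Rintegral integral_indic//; last exact: measurable_vilenkin_I.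
rewrite setIT (mu_vilenkin_I mu_haar) integral0 /=.
have -> : (M n)%:R^-1 = ((M n)%:R^-1)%:C :> R[i].
  by rewrite fmorphV rmorph_nat.
by rewrite !eqxx.
Qed.

End Blocks.

(** * The lacunary series *)

Section LacunarySeries.
Local Open Scope complex_scope.
Variables (R : realType) (m : nat -> nat).
Hypothesis m_gt1 : forall k, (1 < m k)%N.
Variable mu : {measure set (vilenkin m) -> \bar R}.
Hypothesis mu_haar : vilenkin_haar mu.
Variable N : nat -> nat.
Hypothesis N_inc : forall k, (N k < N k.+1)%N.
Implicit Types (x y : vilenkin m) (n k j v : nat).
Local Notation M := (vilenkin_M m).
Local Notation psi := (vilenkin_psi R).
Local Notation block := (block R).

Definition weight k : R := (2 ^ k.+1)%:R^-1.

Lemma weight_gt0 k : 0 < weight k.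
Proof. by rewrite invr_gt0 ltr0n expn_gt0. Qed.

Lemma weight_ge0 k : 0 <= weight k.
Proof. exact/ltW/weight_gt0. Qed.

Lemma sum_weight_le1 K : \sum_(k < K) weight k <= 1.
Proof.
suff -> : \sum_(k < K) weight k = 1 - (2 ^ K)%:R^-1.
  by rewrite lerBlDr lerDl invr_ge0.
elim: K => [|K IH]; first by rewrite big_ord0 expn0 invr1 subrr.
rewrite big_ord_recr /= IH /weight expnS natrM invfM.
have := ltr0Sn R 1; lra.
Qed.

Definition hump K x : R[i] := \sum_(k < K) (weight k)%:C * block (N k) x.

Lemma N_lt i k : (i < k)%N -> (N i < N k)%N.
Proof.
elim: k => // k IH; rewrite ltnS leq_eqVlt => /orP[/eqP -> //|/IH h].
exact: ltn_trans h _.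
Qed.

Lemma N_le i k : (i <= k)%N -> (N i <= N k)%N.
Proof. by rewrite leq_eqVlt => /orP[/eqP -> //|/N_lt/ltnW]. Qed.

Lemma N_ge k : (k <= N k)%N.
Proof. by elim: k => // k IH; exact: leq_ltn_trans IH (N_inc k). Qed.

Lemma step_hump K : step (N K) (hump K).
Proof.
apply: step_bigsum => k _; apply: (step_comp (fun z => (weight k)%:C * z)).
by apply: (step_le (N_lt (ltn_ord k))); exact: step_block.
Qed.

(** Block [k] lives on the cell of level [N k >= k] around zero, so a nonzero coordinate [b] kills
    every block with [k > b]. *)
Lemma hump_stable x b K : x b != 0 -> (b < K)%N -> hump K x = hump b.+1 x.
Proof.
move=> xb bK; rewrite -(subnKC bK) /hump big_split_ord /= [X in _ + X]big1 ?addr0//.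
move=> k _; apply/eqP; rewrite mulf_eq0; apply/orP; right; apply/eqP.
apply: Normc.eq0_normc; rewrite cnorm_block// indicE memNset ?mulr0//.
move=> /(_ b) x0; move: xb; rewrite x0 ?eqxx//.
by rewrite (leq_trans _ (N_ge _))// leq_addr.
Qed.

Lemma hump_limit : exists f : vilenkin m -> R[i], forall x b K,
  x b != 0 -> (b < K)%N -> hump K x = f x.
Proof.
have /choice[f fP] : forall x, exists z, forall b K,
    x b != 0 -> (b < K)%N -> hump K x = z.
  move=> x; have [[b xb]|/forallNP h] := pselect (exists b, x b != 0).
    exists (hump b.+1 x) => b' K xb' bK.
    have [bb|bb] := leqP b b'; first by rewrite (hump_stable xb (leq_ltn_trans bb bK)).
    by rewrite (hump_stable xb' bK) (hump_stable xb' (leqW bb)).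
  (* At the zero sequence the series diverges; the value 0 there is a convention on a null set. *)
  by exists 0 => b K xb; have := h b.
by exists f.
Qed.

(** The majorant of both the partial sums and the maximal function. It takes extended values because
    it is infinite at the zero sequence. *)
Definition envelope x : \bar R :=
  (\sum_(k <oo) (weight k * ((M (N k))%:R * \1_(vilenkin_I (N k) (fun=> 0)) x))%:E)%E.

Let env_term k x :
  weight k * ((M (N k))%:R * \1_(vilenkin_I (N k) (fun=> 0)) x) =
  weight k * cnorm (block (N k) x).
Proof. by rewrite cnorm_block. Qed.

Lemma hump_le_envelope K x : ((cnorm (hump K x))%:E <= envelope x)%E.
Proof.
rewrite /envelope; under eq_eseriesr do rewrite env_term.
apply: (@le_trans _ _ (\sum_(0 <= k < K) (weight k * cnorm (block (N k) x))%:E)%E).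
  rewrite sumEFin lee_fin big_mkord (le_trans (cnorm_sum _ _ _))//.
  apply: ler_sum => k _; rewrite Normc.normcM cnorm_real ger0_norm//.
  exact: weight_ge0.
apply: nneseries_lim_ge => k _ _; rewrite lee_fin mulr_ge0 ?weight_ge0//.
exact: cnorm_ge0.
Qed.

Let measurable_env_term k : measurable_fun setT (fun x : vilenkin m =>
  (weight k * ((M (N k))%:R * \1_(vilenkin_I (N k) (fun=> 0)) x))%:E : \bar R).
Proof.
apply/measurable_EFinP; apply: measurable_funM => //; apply: measurable_funM => //.
apply: measurable_indic; exact: measurable_vilenkin_I.
Qed.

Let env_term_ge0 k x :
  (0 <= (weight k * ((M (N k))%:R * \1_(vilenkin_I (N k) (fun=> 0)) x))%:E)%E.
Proof. by rewrite lee_fin env_term mulr_ge0 ?weight_ge0// cnorm_ge0. Qed.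

Lemma measurable_envelope : measurable_fun setT envelope.
Proof. exact: ge0_emeasurable_sum. Qed.

Lemma envelope_ge0 x : (0 <= envelope x)%E.
Proof. by apply: nneseries_ge0 => k _ _; exact: env_term_ge0. Qed.

(** Each block has norm 1 in [L_1], being of modulus [M (N k)] on a cell of measure [1 / M (N k)],
    and the weights sum to 1. *)
Lemma integral_envelope : (\int[mu]_x envelope x <= 1)%E.
Proof.
rewrite integral_nneseries//.
under eq_eseriesr => k _.
  under eq_integral do rewrite mulrA EFinM.
  rewrite integralZl//; last exact: indic_integrable.
  rewrite integral_indic//; last exact: measurable_vilenkin_I.
  rewrite setIT (mu_vilenkin_I mu_haar) -EFinM -mulrA divff ?mulr1; last first.
    by rewrite pnatr_eq0 -lt0n vilenkin_M_gt0.
  over.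
apply: le_trans (epsilon_trick0 xpredT (@ler01 R)).
by rewrite le_eqVlt; apply/orP; left; apply/eqP/eq_eseriesr => k _; rewrite div1r.
Qed.

Lemma integrable_envelope : mu.-integrable setT envelope.
Proof.
apply/integrableP; split; first exact: measurable_envelope.
under eq_integral do rewrite gee0_abs ?envelope_ge0//.
exact: le_lt_trans integral_envelope (ltry _).
Qed.

(** * Passage to the limit in the lacunary series *)

Let zero : vilenkin m := fun=> 0.

Lemma measurable_zero : measurable [set zero].
Proof.
rewrite (_ : [set zero] = \bigcap_n vilenkin_I n zero).
  by apply: bigcap_measurableType => k _; exact: measurable_vilenkin_I.
apply/seteqP; split => [_ -> //|y h]; apply: functional_extensionality_dep => k.
exact: (h k.+1 I k (ltnSn k)).
Qed.

Lemma mu_zero : mu [set zero] = 0%E.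
Proof.
apply/eqP; rewrite eq_le measure_ge0 andbT; apply/lee_addgt0Pr => e e0.
rewrite add0e.
have [n ne] : exists n, (M n)%:R^-1 <= e.
  exists (Num.truncn e^-1).+1.
  rewrite invf_ple ?posrE ?ltr0n ?vilenkin_M_gt0//.
  rewrite (le_trans (ltW (truncnS_gt _)))// ler_nat.
  exact/ltnW/vilenkin_M_ltn.
apply: le_trans (_ : (mu (vilenkin_I n zero) <= _)%E); last first.
  by rewrite (mu_vilenkin_I mu_haar) lee_fin.
apply: le_measure; rewrite ?inE.
- exact: measurable_zero.
- exact: measurable_vilenkin_I.
- by move=> _ ->.
Qed.

Variable f : vilenkin m -> R[i].
Hypothesis f_lim : forall x b K, x b != 0 -> (b < K)%N -> hump K x = f x.

Lemma hump_cvg (P : R[i] -> R) (h : vilenkin m -> R[i]) x : x != zero ->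
  P (hump K x * h x) @[K --> \oo] --> P (f x * h x).
Proof.
move=> x0; have [b xb] : exists b, x b != 0.
  apply: contrapT => /forallNP e; move/eqP: x0; apply.
  apply: functional_extensionality_dep => b.
  by apply/eqP/negPn/negP; exact: e.
apply: cvg_near_cst; exists b.+1 => // K /= bK.
by rewrite (f_lim xb).
Qed.

(** Dominated convergence with majorant [envelope]. Here [P] stands for the real or the imaginary
    part, and [h] for a conjugated Vilenkin function, the indicator of a cell or the constant 1. *)
Lemma dominated_hump (P : R[i] -> R) (h : vilenkin m -> R[i]) n :
  (forall z, `|P z| <= cnorm z) -> step n h -> (forall x, cnorm (h x) <= 1) ->
  mu.-integrable setT (fun x => (P (f x * h x))%:E) /\
  (\int[mu]_x (P (hump K x * h x))%:E)%E @[K --> \oo] -->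
    (\int[mu]_x (P (f x * h x))%:E)%E.
Proof.
move=> P1 hs h1.
have mh K : measurable_fun setT (fun x => P (hump K x * h x)).
  apply: (@step_measurable _ _ m_gt1 (maxn (N K) n)).
  apply: (step_comp2 (fun z1 z2 => P (z1 * z2))).
    exact: step_le (leq_maxl _ _) (@step_hump K).
  exact: step_le (leq_maxr _ _) hs.
have mf : measurable_fun setT (fun x => P (f x * h x)).
  (* Off the zero sequence the integrand is a pointwise limit of step functions; the zero sequence
     is a measurable singleton. *)
  rewrite -(setUv [set zero]); apply/measurable_funU.
  - exact: measurable_zero.
  - by apply: measurableC; exact: measurable_zero.
  split; first exact: measurable_fun_set1.
  apply: (@measurable_fun_cvg _ _ _ _ (fun K x => P (hump K x * h x))).
    by move=> K; apply: measurable_funTS; exact: mh.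
  by move=> x /eqP x0; exact: (@hump_cvg P h).
have [] := @dominated_convergence _ _ _ mu setT measurableT
  (fun K x => (P (hump K x * h x))%:E) (fun x => (P (f x * h x))%:E) envelope.
- by move=> K; apply/measurable_EFinP.
- exact/measurable_EFinP.
- exists [set zero]; split; [exact: measurable_zero|exact: mu_zero|].
  move=> x /= /not_implyP[_ h0]; apply: contrapT => /eqP x0; apply: h0.
  by apply: cvg_EFin; [exact: nearW|exact: (@hump_cvg P h)].
- exact: integrable_envelope.
- apply: aeW => x K _; apply: le_trans (hump_le_envelope K x).
  by rewrite lee_fin (le_trans (P1 _))// Normc.normcM ler_piMr// cnorm_ge0.
by move=> ? _ ?; split.
Qed.

(** The integrals of the partial sums against [h] converge to that of [f]; if they are eventually
    constant, that constant is the limit. *)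
Lemma Cintegral_limit (h : vilenkin m -> R[i]) n K0 c :
  step n h -> (forall x, cnorm (h x) <= 1) ->
  (forall K, (K0 <= K)%N -> Cintegral mu setT (fun x => hump K x * h x) = c) ->
  Cintegral mu setT (fun x => f x * h x) = c.
Proof.
move=> hs h1 hc.
have aux (P : R[i] -> R) : (forall z, `|P z| <= cnorm z) ->
    (forall K, (K0 <= K)%N -> fine (\int[mu]_x (P (hump K x * h x))%:E)%E = P c) ->
    fine (\int[mu]_x (P (f x * h x))%:E)%E = P c.
  move=> P1 Pc; have [_ l] := dominated_hump P1 hs h1.
  have l' : (\int[mu]_x (P (hump K x * h x))%:E)%E @[K --> \oo] --> (P c)%:E.
    apply: cvg_near_cst; exists K0 => // K /= /Pc <-.
    rewrite (step_integral m_gt1 mu_haar (n := maxn (N K) n))//.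
    apply: (step_comp2 (fun z1 z2 => P (z1 * z2))).
      exact: step_le (leq_maxl _ _) (@step_hump K).
    exact: step_le (leq_maxr _ _) hs.
  by rewrite (cvg_unique _ l l').
apply/eqP; rewrite eq_complex /Cintegral /= /Rintegral; apply/andP; split.
  apply/eqP/aux; first exact: ler_Re_cnorm.
  by move=> K /hc <-.
apply/eqP/aux; first exact: ler_Im_cnorm.
by move=> K /hc <-.
Qed.

Lemma step_hump_sum K n (h : vilenkin m -> R[i]) : step n h ->
  Cintegral mu setT (fun x => hump K x * h x) =
  \sum_(k < K) (weight k)%:C * Cintegral mu setT (fun x => block (N k) x * h x).
Proof.
move=> hs; rewrite -(@step_Cintegral_sum _ _ m_gt1 _ mu_haar _ _ (maxn (N K) n)).
  congr Cintegral; apply/funext => x; rewrite /hump big_distrl.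
  by apply: eq_bigr => k _; rewrite mulrA.
move=> k; apply: (step_comp2 (@GRing.mul _)).
  apply: (fun l => step_le l (@step_block R m m_gt1 (N k))).
  by rewrite (leq_trans (N_lt (ltn_ord k)))// leq_maxl.
exact: step_le (leq_maxr _ _) hs.
Qed.

(** Blocks from [K] on have their spectrum at or above [M (N K)], so they do not reach the
    coefficient [j]. *)
Lemma fourier_coef_limit K j : (j < M (N K))%N ->
  fourier_coef mu f j =
  \sum_(k < K) (weight k)%:C * ((M (N k) <= j < (M (N k)).*2)%N)%:R.
Proof.
move=> jK; have s : step j (fun x => (psi j x)^*).
  apply: (step_comp (fun z => z^*)); apply: step_psi => //.
  exact: vilenkin_M_ltn.
apply: (@Cintegral_limit _ _ K _ s).
  by move=> x; rewrite cnorm_conj cnorm_psi.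
move=> K' KK'; rewrite (step_hump_sum _ s).
under eq_bigr => k _ do rewrite block_coef//.
rewrite -(subnKC KK') big_split_ord /= [X in _ + X]big1 ?addr0// => k _.
by rewrite leqNgt (leq_trans jK) ?mulr0// vilenkin_M_le// N_le// leq_addr.
Qed.

(** Take the least [K] with [n <= N K]. Blocks from [K] on integrate to zero over cells of level
    [n], and by minimality the earlier ones are constant there. Hence the martingale of [f] consists
    of partial sums of the series, which [envelope] dominates. *)
Lemma cell_integral_limit n x : exists K,
  Cintegral mu (vilenkin_I n x) f = hump K x * (M n)%:R^-1.
Proof.
have ex : exists K, (n <= N K)%N by exists n; exact: N_ge.
case: (ex_minnP ex) => K nK Kmin; exists K.
have s := @step_indic R m n x.
have sC : step n (fun y => (\1_(vilenkin_I n x) y : R)%:C).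
  exact: (step_comp (fun z : R => z%:C)).
rewrite Cintegral_restrict; apply: (@Cintegral_limit _ _ K _ sC).
  by move=> y; rewrite cnorm_real indicE; case: (_ \in _); rewrite /= ?normr1 ?normr0.
move=> K' KK'; rewrite (step_hump_sum _ sC) -(subnKC KK') big_split_ord /=.
rewrite [X in _ + X]big1 => [|k _]; last first.
  by rewrite block_martingale ?mulr0// (leq_trans nK)// N_le// leq_addr.
rewrite addr0 /hump big_distrl; apply: eq_bigr => k _ /=.
rewrite block_cst ?mulrA// ltnNge; apply/negP => /Kmin.
by rewrite leqNgt ltn_ord.
Qed.

Lemma maximal_le_envelope x : (maximal mu f x <= envelope x)%E.
Proof.
apply: ge_ereal_sup => _ [n _ <-].
have [K ->] := cell_integral_limit n x.
apply: le_trans (hump_le_envelope K x).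
rewrite (mu_vilenkin_I mu_haar) /= invrK lee_fin Normc.normcM.
rewrite (_ : (M n)%:R^-1 = ((M n)%:R^-1 : R)%:C); last first.
  by rewrite fmorphV rmorph_nat.
rewrite cnorm_real ger0_norm ?invr_ge0// mulrCA mulfV ?mulr1//.
by rewrite pnatr_eq0 -lt0n vilenkin_M_gt0.
Qed.

Lemma maximal_ge0 x : (0 <= maximal mu f x)%E.
Proof.
apply: le_ereal_sup_tmp; eexists; first by exists 0%N.
by rewrite lee_fin mulr_ge0 ?cnorm_ge0// invr_ge0.
Qed.

Lemma hardy_limit : hardy mu f.
Proof.
split; last first.
  apply: le_lt_trans (ltry 1); apply: le_trans integral_envelope.
  apply: ge0_integral_mono; [exact: maximal_ge0|exact: maximal_le_envelope].
have s1 : step 0 ((fun=> 1) : vilenkin m -> R[i]) by [].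
have n1 (x : vilenkin m) : cnorm (1 : R[i]) <= 1 by rewrite Normc.normc1.
split.
  have [+ _] := dominated_hump (@ler_Re_cnorm R) s1 n1.
  by under eq_fun do rewrite mulr1.
have [+ _] := dominated_hump (@ler_Im_cnorm R) s1 n1.
by under eq_fun do rewrite mulr1.
Qed.

Lemma sum_block_coef N' n x : (M N' + M N' <= n)%N ->
  \sum_(j < n) ((M N' <= j < (M N').*2)%N)%:R * psi j x = block N' x.
Proof.
move=> /subnKC <-; rewrite addnn block_sum// big_split_ord /=.
rewrite [X in _ + X]big1 ?addr0 => [|i _]; last first.
  by rewrite [X in _ && X]ltnNge leq_addr andbF mul0r.
rewrite -addnn big_split_ord /= big1 ?add0r => [|i _]; last first.
  by rewrite leqNgt ltn_ord mul0r.
by apply: eq_bigr => i _; rewrite leq_addr ltn_add2l ltn_ord mul1r.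
Qed.

Lemma sum_block_coef_partial N' q x : (q <= M N')%N ->
  \sum_(j < M N' + q) ((M N' <= j < (M N').*2)%N)%:R * psi j x =
  rademacher R N' x * dirichlet R q x.
Proof.
move=> qM; rewrite big_split_ord /= big1 ?add0r => [|i _]; last first.
  by rewrite leqNgt ltn_ord mul0r.
rewrite /dirichlet big_distrr; apply: eq_bigr => i _.
have iM : (i < M N')%N by exact: leq_trans (ltn_ord i) qM.
rewrite leq_addr -addnn ltn_add2l iM mul1r.
by rewrite -{1}[M N']mul1n psi_split.
Qed.

(** The blocks before [K] have their whole spectrum below [M (N K)], block [K] is cut after its
    first [q] terms, and later blocks have not begun. *)
Lemma partial_sum_limit K q x : (q <= M (N K))%N ->
  partial_sum mu f (M (N K) + q) x =
  hump K x + (weight K)%:C * (rademacher R (N K) x * dirichlet R q x).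
Proof.
move=> qM; have nK : (M (N K) + q <= M (N K.+1))%N.
  rewrite (leq_trans (_ : _ <= (M (N K)).*2)%N) -?addnn ?leq_add2l// addnn.
  by rewrite (leq_trans (vilenkin_M_double m_gt1 _))// vilenkin_M_le.
rewrite /partial_sum; under eq_bigr => j _.
  rewrite (fourier_coef_limit (leq_trans (ltn_ord j) nK)) big_distrl /=; over.
rewrite exchange_big big_ord_recr /=; congr (_ + _).
  apply: eq_bigr => k _; under eq_bigr do rewrite -mulrA.
  rewrite -big_distrr sum_block_coef// addnn.
  rewrite (leq_trans (vilenkin_M_double m_gt1 _))//.
  by rewrite (leq_trans (vilenkin_M_le m_gt1 (N_lt (ltn_ord k))))// leq_addr.
under eq_bigr do rewrite -mulrA.
by rewrite -big_distrr sum_block_coef_partial.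
Qed.

Lemma cnorm_fourier_coef_le1 j : cnorm (fourier_coef mu f j) <= 1.
Proof.
have jK : (j < M (N j))%N.
  by rewrite (leq_trans (vilenkin_M_ltn m_gt1 j))// vilenkin_M_le// N_ge.
rewrite (fourier_coef_limit jK) (le_trans (cnorm_sum _ _ _))//.
apply: le_trans (sum_weight_le1 j); apply: ler_sum => k _.
rewrite Normc.normcM cnorm_real ger0_norm ?weight_ge0// cnorm_nat.
by rewrite ler_piMr ?weight_ge0//; case: (_ && _).
Qed.

Lemma cnorm_hump_le K x : cnorm (hump K.+1 x) <= (M (N K))%:R.
Proof.
rewrite (le_trans (cnorm_sum _ _ _))//.
apply: (@le_trans _ _ (\sum_(k < K.+1) weight k * (M (N K))%:R)).
  apply: ler_sum => k _; rewrite Normc.normcM cnorm_real ger0_norm ?weight_ge0//.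
  rewrite ler_wpM2l ?weight_ge0// (le_trans (cnorm_block_le _ _ _ _))//.
  by rewrite ler_nat vilenkin_M_le// N_le// -ltnS.
by rewrite -big_distrl /= ler_piMl// sum_weight_le1.
Qed.

End LacunarySeries.

(** * Comparison of logarithmic means with partial sums *)

Section LogarithmicMeans.
Local Open Scope complex_scope.
Variables (R : realType) (m : nat -> nat).
Hypothesis m_gt1 : forall k, (1 < m k)%N.
Variable mu : {measure set (vilenkin m) -> \bar R}.
Hypothesis mu_haar : vilenkin_haar mu.
Implicit Types (x y : vilenkin m) (n k j v : nat).
Local Notation M := (vilenkin_M m).

Definition harmonic_sum n : R := \sum_(1 <= k < n.+1) k%:R^-1.

Lemma harmonic_sum_mono n n' : (n <= n')%N -> harmonic_sum n <= harmonic_sum n'.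
Proof.
move=> nn; rewrite /harmonic_sum [leRHS](big_cat_nat _ (n := n.+1)) //= lerDl.
by apply: sumr_ge0 => k _; rewrite invr_ge0.
Qed.

(** The dyadic range from [2 ^ a + 1] to [2 ^ a.+1] has [2 ^ a] terms, each at least [1 / 2 ^ a.+1],
    so every doubling adds at least one half. *)
Lemma harmonic_sum_ge a : a%:R / 2 <= harmonic_sum (2 ^ a).
Proof.
elim: a => [|a IH].
  by rewrite mul0r; apply: sumr_ge0 => k _; rewrite invr_ge0.
have p0 : (0 < 2 ^ a)%N by rewrite expn_gt0.
rewrite /harmonic_sum (big_cat_nat _ (n := (2 ^ a).+1)) //=; last first.
  by rewrite ltnS leq_exp2l.
rewrite -natr1 mulrDl lerD// mul1r.
apply: (@le_trans _ _ (\sum_((2 ^ a).+1 <= k < (2 ^ a.+1).+1) (2 ^ a.+1)%:R^-1)).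
  rewrite big_const_nat iter_addr_0 subSS expnS mul2n -addnn addnK addnn -mul2n.
  rewrite -[X in _ <= X]mulr_natr natrM invfM mulfVK//.
apply: ler_sum_nat => k /andP[k1 k2].
rewrite lef_pV2 ?posrE ?ltr0n ?expn_gt0//; last by rewrite (leq_ltn_trans _ k1).
by rewrite ler_nat -ltnS.
Qed.

Lemma harmonic_sum_gt0 n : (0 < n)%N -> 0 < harmonic_sum n.
Proof.
move=> n0; apply: lt_le_trans (harmonic_sum_mono n0).
by rewrite /harmonic_sum big_nat1 invr1.
Qed.

Lemma harmonic_sum_rev n : harmonic_sum n = \sum_(k < n) (n - k)%:R^-1.
Proof.
rewrite /harmonic_sum big_add1 /= big_mkord (reindex_inj rev_ord_inj) /=.
apply: eq_bigr => k _; congr (_%:R^-1).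
by rewrite subnSK.
Qed.

Lemma partial_sum_lipschitz (f : vilenkin m -> R[i]) n k x :
  (forall j, cnorm (fourier_coef mu f j) <= 1) -> (k <= n)%N ->
  cnorm (partial_sum mu f n x - partial_sum mu f k x) <= (n - k)%:R.
Proof.
move=> f1 /subnKC <-; rewrite /partial_sum big_split_ord /= addrAC subrr add0r addKn.
rewrite (le_trans (cnorm_sum _ _ _))// -[X in _ <= X%:R]card_ord -sumr_const.
apply: ler_sum => j _; rewrite Normc.normcM cnorm_psi ?mulr1; exact: f1.
Qed.

(* The Lipschitz bound cancels the weights [1 / (n - k)], which sum to [l_n]. *)
Lemma log_mean_close (f : vilenkin m -> R[i]) n x : (0 < n)%N ->
  (forall j, cnorm (fourier_coef mu f j) <= 1) ->
  cnorm (partial_sum mu f n x - log_mean mu f n x) <= n%:R / harmonic_sum n.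
Proof.
move=> n0 f1; have l0 := harmonic_sum_gt0 n0.
have natC k : (k%:R^-1 : R[i]) = (k%:R^-1 : R)%:C by rewrite fmorphV rmorph_nat.
have lC : (\sum_(1 <= k < n.+1) k%:R^-1)^-1 = ((harmonic_sum n)^-1)%:C :> R[i].
  rewrite fmorphV; congr (_^-1); rewrite rmorph_sum.
  by apply: eq_bigr => k _; exact: natC.
have -> : partial_sum mu f n x - log_mean mu f n x = ((harmonic_sum n)^-1)%:C *
    \sum_(k < n) (partial_sum mu f n x - partial_sum mu f k x) / (n - k)%:R.
  have e z : z = ((harmonic_sum n)^-1)%:C * ((harmonic_sum n)%:C * z).
    by rewrite mulrA -rmorphM mulVf ?lt0r_neq0// rmorph1 mul1r.
  rewrite /log_mean lC {1}[partial_sum mu f n x]e -mulrBr; congr (_ * _).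
  rewrite {1}harmonic_sum_rev rmorph_sum big_distrl -sumrB; apply: eq_bigr => k _.
  by rewrite mulrBl natC [in RHS]mulrC.
rewrite Normc.normcM cnorm_real ger0_norm ?invr_ge0 ?(ltW l0)// mulrC.
rewrite ler_wpM2r ?invr_ge0 ?(ltW l0)// (le_trans (cnorm_sum _ _ _))//.
rewrite -[X in _ <= X%:R]card_ord -sumr_const; apply: ler_sum => k _.
rewrite Normc.normcM natC cnorm_real ger0_norm// ler_pdivrMr.
  by rewrite mul1r partial_sum_lipschitz// ltnW.
by rewrite ltr0n subn_gt0.
Qed.

(** The sets [first_nonzero (a + s.*2)] are disjoint because the position of the first nonzero
    coordinate is unique. On each, the bound [C * M b] meets a measure of at least [1 / (2 * M b)],
    so each of the [T] sets adds [C / 2]. *)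
Lemma integral_first_nonzero_ge (h : vilenkin m -> R) a T (C : R) :
  0 <= C -> (forall x, 0 <= h x) ->
  (forall s x, (s < T)%N -> first_nonzero (a + s.*2) x ->
    C * (M (a + s.*2))%:R <= h x) ->
  ((T%:R * (C / 2))%:E <= \int[mu]_x (h x)%:E)%E.
Proof.
move=> C0 h0 hC; pose E s := @first_nonzero m (a + s.*2).
have mE s : measurable (E s) by exact: measurable_first_nonzero.
pose c s : R := C * (M (a + s.*2))%:R.
have c0 s : 0 <= c s by rewrite mulr_ge0.
apply: (@le_trans _ _ (\int[mu]_x (\sum_(s < T) (c s)%:E * (\1_(E s) x)%:E))%E).
  rewrite ge0_integral_sum//; last 2 first.
  - move=> s; apply: measurable_funeM; apply/measurable_EFinP.
    exact: (@measurable_indic _ _ R setT _ (mE s)).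
  - by move=> s x _; rewrite -EFinM lee_fin mulr_ge0// indicE.
  have -> : (T%:R * (C / 2))%:E = (\sum_(s < T) (C / 2)%:E)%E.
    by rewrite sumEFin sumr_const card_ord mulr_natl.
  apply: lee_sum => s _; rewrite ge0_integralZl//.
  - rewrite integral_indic// setIT.
    apply: (@le_trans _ _ ((c s)%:E * ((2 * (M (a + s.*2))%:R)^-1)%:E)%E).
      rewrite -EFinM lee_fin /c invfM mulrACA divff ?mulr1//.
      by rewrite pnatr_eq0 -lt0n vilenkin_M_gt0.
    by rewrite lee_wpmul2l ?lee_fin//; exact: mu_first_nonzero.
  - by apply/measurable_EFinP; exact: (@measurable_indic _ _ R setT _ (mE s)).
  - by rewrite lee_fin.
apply: ge0_integral_mono => x.
  by apply: sume_ge0 => s _; rewrite -EFinM lee_fin mulr_ge0// indicE.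
under eq_bigr do rewrite -EFinM.
rewrite sumEFin lee_fin.
have [[s Es]|/forallNP nE] := pselect (exists s : 'I_T, E s x).
  rewrite (bigD1 s)//= big1 ?addr0 => [|t ts].
    by rewrite indicE mem_set// mulr1; exact: hC.
  rewrite indicE memNset ?mulr0// => Et.
  have disj (u v : nat) : (u < v)%N -> E u x -> E v x -> False.
    move=> uv [_ /negP nu] [v0 _]; apply: nu; apply/eqP/v0.
    by rewrite ltn_add2l ltn_double.
  have [st|st|/val_inj e] := ltngtP s t.
  - exact: disj st Es Et.
  - exact: disj st Et Es.
  - by rewrite e eqxx in ts.
by rewrite big1// => s _; rewrite indicE memNset ?mulr0//; exact: nE.
Qed.

End LogarithmicMeans.

(** * Choice of the scales *)

Section Scales.
Variables (m : nat -> nat) (B : nat).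
Hypothesis m_gt1 : forall k, (1 < m k)%N.
Hypothesis m_le : forall k, (m k <= B)%N.
Local Notation M := (vilenkin_M m).

Lemma vilenkin_M_addl a d : (2 ^ d * M a <= M (a + d))%N.
Proof.
elim: d => [|d IH]; first by rewrite mul1n addn0.
by rewrite addnS vilenkin_MS expnS -mulnA mulnC leq_mul ?m_gt1.
Qed.

Lemma vilenkin_M_addr a d : (M (a + d) <= B ^ d * M a)%N.
Proof.
elim: d => [|d IH]; first by rewrite mul1n addn0.
by rewrite addnS vilenkin_MS expnSr mulnAC leq_mul.
Qed.

(** Chosen so that [scale_count K * weight K / 8 = 2 ^ K]. *)
Definition scale_count K : nat := 4 ^ K.+2.

(* The first summand makes [n / l_n], the second one the first [K] terms of the
   series, at most [weight K * M (scale_start K) / 8]. *)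
Fixpoint scale_start K : nat :=
  2 ^ (K + 6) * B ^ (scale_count K).*2.+1 +
  (if K is K'.+1 then scale_start K' + (scale_count K').*2.+1 + K + 4 else 0).

Definition scale_end K : nat := scale_start K + (scale_count K).*2.+1.

Lemma scale_start_ge K :
  (2 ^ (K + 6) * B ^ (scale_count K).*2.+1 <= scale_start K)%N.
Proof. by case: K => [|K]; exact: leq_addr. Qed.

Lemma scale_startS K : (scale_end K + (K + 5) <= scale_start K.+1)%N.
Proof.
rewrite /= -/(scale_end K); apply: leq_trans (leq_addl _ _).
by lia.
Qed.

Lemma scale_end_inc K : (scale_end K < scale_end K.+1)%N.
Proof.
rewrite {2}/scale_end addnS ltnS (leq_trans _ (leq_addr _ _))//.
exact: leq_trans (leq_addr _ _) (scale_startS K).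
Qed.

Variable R : realType.
Local Notation hump := (hump R scale_end).

(** The earlier terms are at most [M (scale_end K)] when [K + 1] of them are summed. The spacing
    [K + 5] before the next start gains [2 ^ (K + 5)], which is [8 / weight K.+1]. *)
Lemma hump_scale_le K (x : vilenkin m) :
  cnorm (hump K x) <= weight R K * ((M (scale_start K))%:R / 8).
Proof.
case: K => [|K].
  rewrite [X in cnorm X]big_ord0 Normc.normc0 mulr_ge0 ?weight_ge0//.
apply: le_trans (cnorm_hump_le R m_gt1 scale_end_inc K x) _.
have : (2 ^ (K + 5) * M (scale_end K) <= M (scale_start K.+1))%N.
  apply: leq_trans (vilenkin_M_addl _ _) _.
  exact: vilenkin_M_le (scale_startS K).
rewrite -(ler_nat R) natrM => h.
have w0 := weight_gt0 R K.+1.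
have e : weight R K.+1 * (2 ^ (K + 5))%:R = 8.
  by rewrite /weight -addSnnS -addSnnS expnD natrM mulrA mulVf ?mul1r//.
have : weight R K.+1 * ((2 ^ (K + 5))%:R * (M (scale_end K))%:R) <=
  weight R K.+1 * (M (scale_start K.+1))%:R by rewrite ler_pM2l.
rewrite mulrA e; lra.
Qed.

Definition log_index K : nat :=
  (M (scale_end K) + lacunary m (scale_start K) (scale_count K))%N.

Lemma lacunary_scale_le K :
  (lacunary m (scale_start K) (scale_count K) <= M (scale_end K))%N.
Proof. by rewrite /scale_end addnS; exact: lacunary_le1. Qed.

Lemma log_index_gt0 K : (0 < log_index K)%N.
Proof. by rewrite addn_gt0 vilenkin_M_gt0. Qed.

(** With [a] the start and [d] the length of the scale, the index is at most [2 * B ^ d * M a]. It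
    is also at least [2 ^ a], which makes the harmonic sum at least [a / 2]. The choice
    [a >= 2 ^ (K + 6) * B ^ d] then bounds the quotient by [M a / 2 ^ (K + 4)]. *)
Lemma log_index_le K :
  (log_index K)%:R / harmonic_sum R (log_index K) <=
  weight R K * ((M (scale_start K))%:R / 8).
Proof.
set a := scale_start K; set d := (scale_count K).*2.+1.
have a0 : (0 < a)%N.
  apply: leq_trans (scale_start_ge K).
  rewrite muln_gt0 !expn_gt0 /= (leq_trans _ (m_le 0))//.
  by rewrite ltnW.
have l_ge : a%:R / 2 <= harmonic_sum R (log_index K).
  apply: le_trans (harmonic_sum_ge R a) _; apply: harmonic_sum_mono.
  apply: leq_trans (leq_addr _ _).
  rewrite (leq_trans _ (vilenkin_M_le m_gt1 (leq_addr _ _)))//.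
  by have := vilenkin_M_addl 0 a; rewrite add0n /vilenkin_M big_ord0 muln1.
have l0 : 0 < harmonic_sum R (log_index K).
  by apply: lt_le_trans l_ge; rewrite divr_gt0 ?ltr0n.
rewrite ler_pdivrMr//.
apply: (@le_trans _ _ (weight R K * ((M a)%:R / 8) * (a%:R / 2))); last first.
  by rewrite ler_wpM2l// mulr_ge0 ?weight_ge0.
have n_le : (log_index K <= 2 * (B ^ d * M a))%N.
  rewrite mul2n -addnn leq_add ?vilenkin_M_addr//.
  exact: leq_trans (lacunary_scale_le K) (vilenkin_M_addr _ _).
rewrite (le_trans (_ : _ <= (2 * (B ^ d * M a))%:R)) ?ler_nat//.
have : (2 ^ (K + 6) * B ^ d <= a)%N by exact: scale_start_ge.
rewrite -(ler_nat R) => h.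
have e : weight R K * (2 ^ (K + 6))%:R = 32.
  by rewrite /weight -addSnnS expnD natrM mulrA mulVf ?mul1r//.
have : weight R K * ((2 ^ (K + 6))%:R * (B ^ d)%:R) <= weight R K * a%:R.
  by rewrite ler_pM2l ?weight_gt0// -natrM.
rewrite mulrA e => {}h.
have : 32 * (B ^ d)%:R * (M a)%:R <= weight R K * a%:R * (M a)%:R.
  by rewrite ler_wpM2r.
rewrite !natrM; lra.
Qed.

End Scales.

(** * Growth of the norms along the indices [log_index] *)

Theorem theorem1 (R : realType) (m : nat -> nat)
    (m_ge2 : forall k, (2 <= m k)%N)
    (m_bounded : exists B : nat, forall k, (m k <= B)%N)
    (mu : {measure set (vilenkin m) -> \bar R})
    (mu_haar : vilenkin_haar mu) :
  exists f : vilenkin m -> R[i],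
    hardy mu f /\
    ereal_sup [set norm1 mu (log_mean mu f n) | n in [set n : nat | (0 < n)%N]]
      = +oo%E.
Proof.
have [B m_le] := m_bounded.
have N_inc := @scale_end_inc B.
have [f f_lim] := hump_limit R m_ge2 N_inc.
exists f; split; first exact: (hardy_limit m_ge2 mu_haar N_inc f_lim).
suff norm_ge K : ((2 ^ K)%:R%:E <= norm1 mu (log_mean mu f (log_index m B K)))%E.
  apply/eqyP => A A0.
  apply: (@le_trans _ _ (2 ^ (Num.truncn A).+1)%:R%:E).
    rewrite lee_fin (le_trans (ltW (truncnS_gt _)))// ler_nat.
    exact/ltnW/ltn_expl.
  apply: le_trans (norm_ge _) _; apply: ereal_sup_ubound.
  by exists (log_index m B (Num.truncn A).+1) => //; exact: log_index_gt0.
set a := scale_start B K; set T := scale_count K.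
have w0 := weight_gt0 R K.
(* The factor [weight R K / 4] is the pointwise constant to be proved on the sets [first_nonzero],
   and the last division by 2 comes from their measure. *)
have -> : (2 ^ K)%:R = T%:R * (weight R K / 4 / 2) :> R.
  rewrite /T /scale_count /weight (_ : 4 ^ K.+2 = 2 ^ K.+1 * (8 * 2 ^ K))%N; last first.
    by rewrite -[4%N]/(2 * 2)%N expnMn !expnS; ring.
  rewrite !natrM; field.
  by rewrite natrX expf_neq0// pnatr_eq0.
rewrite /norm1.
apply: (integral_first_nonzero_ge m_ge2 mu_haar (a := a)).
- by rewrite divr_ge0// ltW.
- by move=> x; exact: cnorm_ge0.
move=> s x sT xs.
have D_ge := dirichlet_lacunary_ge R m_ge2 (ltnW sT) xs.
have close := log_mean_close x (log_index_gt0 B m_ge2 K)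
  (cnorm_fourier_coef_le1 m_ge2 mu_haar N_inc f_lim).
have h_le := hump_scale_le B m_ge2 R K x.
have n_le := log_index_le m_ge2 m_le R K.
have sum_eq := partial_sum_limit m_ge2 mu_haar N_inc f_lim x
  (lacunary_scale_le B m_ge2 K).
set L := log_mean _ _ _ _ in close *; set S := partial_sum _ _ _ _ in close.
set u := hump R (scale_end B) K x in sum_eq; set D := dirichlet R _ x in D_ge sum_eq.
have M_le : (vilenkin_M m a)%:R <= (vilenkin_M m (a + s.*2))%:R :> R.
  by rewrite ler_nat vilenkin_M_le// leq_addr.
(* The new part of [S] is [L + (S - L) - u]. Its modulus is at least [weight R K * M b / 2] with
   [b = a + s.*2]; the error [S - L] and the older terms [u] each cost at most
   [weight R K * M a / 8]. As [M a <= M b], at least [weight R K * M b / 4] is left for [L]. *)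
have : cnorm ((weight R K)%:C%C * (rademacher R (scale_end B K) x * D)) <=
    cnorm L + cnorm (S - L) + cnorm u.
  have -> : (weight R K)%:C%C * (rademacher R (scale_end B K) x * D) =
      L + (S - L) + - u by rewrite [S]sum_eq; ring.
  by rewrite (le_trans (le_normcD _ _))// normcN lerD2r le_normcD.
rewrite !Normc.normcM cnorm_rademacher mul1r cnorm_real ger0_norm ?(ltW w0)//.
have : weight R K * ((vilenkin_M m (a + s.*2))%:R / 2) <= weight R K * cnorm D.
  by rewrite ler_pM2l.
have : weight R K * (vilenkin_M m a)%:R <= weight R K * (vilenkin_M m (a + s.*2))%:R.
  by rewrite ler_pM2l.
move: close h_le n_le; rewrite -/a -/u; lra.
Qed.
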